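(* Let $\{\mathcal{T}(t)\}_{t\in[t_n,t_{n+1}]}$ be a simplicial mesh of $\Omega(t)\subset\mathbb{R}^d$ moving with arbitrary vertex velocities that are constant in time on $[t_n,t_{n+1}]$, with mesh velocity $\mathbf{w}$, and let $\mathbf{c}\in\mathbb{R}^N$ be a constant vector with $\nabla_{\mathbf{x}}\cdot\mathcal{F}(\mathbf{x},t,\mathbf{c})=0$ for all $\mathbf{x}$ and $t$. Suppose the discrete solution at time $t_n$ is the constant $\mathbf{u}(\cdot,t_n)\equiv\mathbf{c}$ and that the predictor is $\tilde{\mathbf{u}}(\mathbf{x},t)\equiv\mathbf{c}$ on $[t_n,t_{n+1}]$ (as holds for any consistent predictor). Let the discrete solution $\mathbf{u}(\cdot,t_{n+1})$ be defined by the ALE DG scheme $$\int_{K(t_{n+1})}\mathbf{u}(\mathbf{x},t_{n+1})\,\phi_m(\mathbf{x},t_{n+1})\,d\mathbf{x}-\int_{K(t_n)}\mathbf{u}(\mathbf{x},t_n)\,\phi_m(\mathbf{x},t_n)\,d\mathbf{x}=\int_{t_n}^{t_{n+1}}\!\!\int_{K(t)}\mathcal{G}(\mathbf{x},t,\tilde{\mathbf{u}},\mathbf{w})\cdot\nabla_{\mathbf{x}}\phi_m(\mathbf{x},t)\,d\mathbf{x}\,dt-\int_{t_n}^{t_{n+1}}\!\!\int_{\partial K(t)}\mathcal{H}(\mathbf{x},t,\tilde{\mathbf{u}}^-,\tilde{\mathbf{u}}^+,\mathbf{w};\boldsymbol{\nu})\,\phi_m\,ds\,dt$$ for every cell $K$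 and every basis index $m$. Then $\mathbf{u}(\cdot,t_{n+1})\equiv\mathbf{c}$.
   Context: Conservation law: $\partial_t\mathbf{u}+\nabla_{\mathbf{x}}\cdot\mathcal{F}(\mathbf{x},t,\mathbf{u})=0$ with $\mathbf{u}\in\mathbb{R}^N$ and smooth flux $\mathcal{F}=(\mathbf{F}_1,\dots,\mathbf{F}_d)$, $\mathbf{F}_i(\mathbf{x},t,\mathbf{u})\in\mathbb{R}^N$; $\nabla_{\mathbf{x}}\cdot\mathcal{F}(\mathbf{x},t,\mathbf{c})=\sum_i\partial_{x_i}\mathbf{F}_i(\mathbf{x},t,\mathbf{c})$. Moving mesh: $\mathcal{T}(t)$ is a conforming simplicial mesh of $\Omega(t)$ with fixed connectivity on $[t_n,t_{n+1}]$. Each vertex moves with a velocity constant in time on $[t_n,t_{n+1}]$, and all cells $K(t)$ remain nondegenerate and positively oriented. In each cell the mesh velocity $\mathbf{w}(\mathbf{x},t)\in\mathbb{R}^d$ is the barycentric (affine) interpolation of the velocities of the $d+1$ vertices of the cell; thus $K(t)$ is the image of a fixed reference simplex $\hat K$ under a time-dependent affine map $\boldsymbol{\xi}\mapsto\mathbf{x}(\boldsymbol{\xi},t)$ with $\partial_t\mathbf{x}(\boldsymbol{\xi},t)=\mathbf{w}(\mathbf{x}(\boldsymbol{\xi},t),t)$. Basis: fix $k\ge 0$ and a basis $\hat\phi_0,\hat\phi_1,\dots$ of the polynomials of degree at most $k$ on $\hat K$, orthonormal in $L^2(\hat K)$, with $\hat\phi_0$ a nonzero constant. On $K(t)$ set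 $\phi_m(\mathbf{x}(\boldsymbol{\xi},t),t)=\hat\phi_m(\boldsymbol{\xi})$. The discrete solution at time $t$ is, on each cell, $\mathbf{u}(\mathbf{x},t)=\sum_m\mathbf{u}_m(t)\phi_m(\mathbf{x},t)$ with $\mathbf{u}_m(t)\in\mathbb{R}^N$. Fluxes: the ALE flux is $\mathcal{G}(\mathbf{x},t,\mathbf{u},\mathbf{w})=\mathcal{F}(\mathbf{x},t,\mathbf{u})-\mathbf{u}\otimes\mathbf{w}$, i.e. $\mathcal{G}\cdot\mathbf{v}=\sum_{i=1}^d(\mathbf{F}_i(\mathbf{x},t,\mathbf{u})-w_i\mathbf{u})v_i$ for $\mathbf{v}\in\mathbb{R}^d$. $\mathcal{H}(\mathbf{x},t,\mathbf{u}^-,\mathbf{u}^+,\mathbf{w};\boldsymbol{\nu})\in\mathbb{R}^N$ is a numerical flux that is consistent: $\mathcal{H}(\mathbf{x},t,\mathbf{u},\mathbf{u},\mathbf{w};\boldsymbol{\nu})=\mathcal{G}(\mathbf{x},t,\mathbf{u},\mathbf{w})\cdot\boldsymbol{\nu}$ for all $\mathbf{u},\mathbf{w},\boldsymbol{\nu}$. Here $\boldsymbol{\nu}$ is the outward unit normal to $\partial K(t)$, and $\tilde{\mathbf{u}}^-$, $\tilde{\mathbf{u}}^+$ are the traces of the predictor from inside and outside $K(t)$. On boundary faces of $\Omega(t)$ the exterior state is the one given by the constant solution (for example periodic boundaries), so that $\tilde{\mathbf{u}}^\pm=\mathbf{c}$ on all faces when $\tilde{\mathbf{u}}\equiv\mathbf{c}$.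 The predictor $\tilde{\mathbf{u}}(\mathbf{x},t)$ is an approximation on $[t_n,t_{n+1}]$ computed from $\mathbf{u}(\cdot,t_n)$. *)

(* Defs.v *)
From HB Require Import structures.
From mathcomp Require Import all_boot all_order all_algebra.
(* The notations of mpoly clash with those of MathComp-Analysis: {mpoly R[n]}
   is [mpoly n R], p.@[v] is [meval v p] and c%:MP is [mpolyC n c]. *)
From mathcomp Require Import -(notations) mpoly.
From mathcomp Require Import all_classical all_reals all_analysis.

Set Implicit Arguments.
Unset Strict Implicit.
Unset Printing Implicit Defensive.

Import Order.TTheory GRing.Theory Num.Theory numFieldNormedType.Exports.

Local Open Scope classical_set_scope.
Local Open Scope ring_scope.

Definition tuple_cons (T : Type) n (p : T * n.-tuple T) : n.+1.-tuple T :=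
  [tuple of p.1 :: p.2].

Definition tuple_uncons (T : Type) n (t : n.+1.-tuple T) : T * n.-tuple T :=
  (thead t, [tuple of behead t]).

Lemma tuple_consK (T : Type) n : cancel (@tuple_cons T n) (@tuple_uncons T n).
Proof. by case=> x t; congr pair; exact/val_inj. Qed.

Lemma tuple_unconsK (T : Type) n : cancel (@tuple_uncons T n) (@tuple_cons T n).
Proof. by move=> t; rewrite [RHS]tuple_eta; exact/val_inj. Qed.

Lemma measurable_tuple_cons d (T : measurableType d) n :
  measurable_fun [set: T * n.-tuple T] (@tuple_cons T n).
Proof. exact: measurable_cons. Qed.

Lemma measurable_tuple_uncons d (T : measurableType d) n :
  measurable_fun [set: n.+1.-tuple T] (@tuple_uncons T n).
Proof.
apply/measurable_fun_pairP; split.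
  exact: (measurable_tnth ord0).
exact: measurable_behead.
Qed.

Section lebesgue_cons.
Variables (R : realType) (n : nat).
Local Notation T := (measurableTypeR R).
Variable mu : {sigma_finite_measure set (n.-tuple T) -> \bar R}.

Definition lebesgue_cons : set (n.+1.-tuple T) -> \bar R :=
  pushforward (@lebesgue_measure R \x mu)%E (@tuple_cons T n).

HB.instance Definition _ := Measure.copy lebesgue_cons
  (measure_function_pushforward__canonical__measure_function_Measure
    (@lebesgue_measure R \x mu : {measure set _ -> \bar _})%E
    (@measurable_tuple_cons _ T n)).

Let lebesgue_cons_sigma_finite : sigma_finite setT lebesgue_cons.
Proof.
have /sigma_finiteP[F [TF ndF Foo]] := sigma_finiteT (@lebesgue_measure R).
have /sigma_finiteP[G [TG ndG Goo]] := sigma_finiteT mu.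
exists (fun k => @tuple_uncons T n @^-1` (F k `*` G k)).
  apply/esym; rewrite -preimage_bigcup -subTset => t _ /=.
  have [i _ Fi] : (\bigcup_k F k) (tuple_uncons t).1 by rewrite -TF.
  have [j _ Gj] : (\bigcup_k G k) (tuple_uncons t).2 by rewrite -TG.
  exists (maxn i j) => //; split.
    by move: Fi; exact/subsetPset/ndF/leq_maxl.
  by move: Gj; exact/subsetPset/ndG/leq_maxr.
move=> k; have [mF Fk] := Foo k; have [mG Gk] := Goo k; split.
  rewrite -[X in measurable X]setTI.
  by apply: measurable_tuple_uncons => //; exact: measurableX.
rewrite /lebesgue_cons /pushforward -comp_preimage.
have -> : @tuple_uncons T n \o @tuple_cons T n = id.
  by apply/funext => p /=; rewrite tuple_consK.
by rewrite preimage_id product_measure1E// lte_mul_pinfty// ge0_fin_numE.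
Qed.

HB.instance Definition _ := Measure_isSigmaFinite.Build _ _ _ lebesgue_cons
  lebesgue_cons_sigma_finite.

End lebesgue_cons.

(* Lebesgue measure on R^n, on the Borel sets of [n.-tuple R]: the iterated
   product of the one-dimensional measure (a Dirac mass for [n = 0]). *)
Fixpoint lebesgue_tuple (R : realType) n :
    {sigma_finite_measure set (n.-tuple (measurableTypeR R)) -> \bar R} :=
  match n with
  | 0 => \d_ [tuple]
  | m.+1 => lebesgue_cons (lebesgue_tuple R m)
  end.

Definition row_of_tuple (R : realType) n (t : n.-tuple R) : 'rV[R]_n :=
  \row_i tnth t i.

Definition vol_int (R : realType) n (D : set 'rV[R]_n) (f : 'rV[R]_n -> R) : R :=
  (\int[lebesgue_tuple R n]_(y in @row_of_tuple R n @^-1` D)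
     f (row_of_tuple y))%R.

Definition vol_intv (R : realType) n N (D : set 'rV[R]_n)
    (f : 'rV[R]_n -> 'rV[R]_N) : 'rV[R]_N :=
  \row_j vol_int D (fun x => f x 0 j).

Definition time_intv (R : realType) N (a b : R) (f : R -> 'rV[R]_N) : 'rV[R]_N :=
  \row_j (\int[lebesgue_measure]_(t in `[a, b]) f t 0 j)%R.

Definition hull (R : realType) (I : finType) d (S : {set I})
    (P : I -> 'rV[R]_d) : set 'rV[R]_d :=
  [set x | exists a : I -> R, [/\ forall i, 0 <= a i,
    forall i, i \notin S -> a i = 0, \sum_i a i = 1 & x = \sum_i a i *: P i]].

Definition simplex (R : realType) n d (P : 'I_n.+1 -> 'rV[R]_d) : set 'rV[R]_d :=
  hull [set: 'I_n.+1] P.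

Definition edge_mx (R : realType) n d (P : 'I_n.+1 -> 'rV[R]_d) : 'M[R]_(n, d) :=
  \matrix_(i < n) (P (lift ord0 i) - P ord0).

(* The affine function with value [V i] at the vertex [P i]:
   barycentric interpolation on the simplex [P]. *)
Definition bary_interp (R : realType) d m (P : 'I_d.+1 -> 'rV[R]_d)
    (V : 'I_d.+1 -> 'rV[R]_m) (x : 'rV[R]_d) : 'rV[R]_m :=
  V ord0 + (x - P ord0) *m invmx (edge_mx P) *m edge_mx V.

Lemma bary_interp_vertex (R : realType) d m (P : 'I_d.+1 -> 'rV[R]_d)
    (V : 'I_d.+1 -> 'rV[R]_m) i :
  edge_mx P \in unitmx -> bary_interp P V (P i) = V i.
Proof.
move=> uP; rewrite /bary_interp; have [j ->|->] := unliftP ord0 i; last first.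
  by rewrite subrr !mul0mx addr0.
have -> : P (lift ord0 j) - P ord0 = row j (edge_mx P) by rewrite rowK.
by rewrite -row_mul mulmxV // -row_mul mul1mx rowK addrC subrK.
Qed.

Definition std_simplex (R : realType) n : set 'rV[R]_n :=
  [set y | (forall i, 0 <= y 0 i) /\ \sum_i y 0 i <= 1].

(* Integral over the n-simplex [Q] of R^d with respect to the n-dimensional
   surface measure: the Gram factor of the affine parametrization
   [y |-> Q ord0 + y *m edge_mx Q] times the integral over the parameters. *)
Definition surf_intv (R : realType) n d N (Q : 'I_n.+1 -> 'rV[R]_d)
    (f : 'rV[R]_d -> 'rV[R]_N) : 'rV[R]_N :=
  Num.sqrt (\det (edge_mx Q *m (edge_mx Q)^T)) *:
    vol_intv (@std_simplex R n) (fun y => f (Q ord0 + y *m edge_mx Q)).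

(* The norm of the normed module ['rV[R]_d] is the sup norm, hence the explicit
   Euclidean inner product. *)
Definition dotv (R : realType) d (u v : 'rV[R]_d) : R := \sum_i u 0 i * v 0 i.

(* [nu] is the outward unit normal of the face of [P] opposite to [P i]. *)
Definition is_outward_unit_normal (R : realType) d (P : 'I_d.+1 -> 'rV[R]_d)
    (i : 'I_d.+1) (nu : 'rV[R]_d) : Prop :=
  [/\ dotv nu nu = 1,
      forall j k, j != i -> k != i -> dotv (P j - P k) nu = 0 &
      forall j, j != i -> dotv (P i - P j) nu < 0].

Definition grad (R : realType) d (f : 'rV[R]_d -> R) (x : 'rV[R]_d) : 'rV[R]_d :=
  \row_i 'D_(delta_mx 0 i) f x.

Definition divergence (R : realType) d N (G : 'I_d -> 'rV[R]_d -> 'rV[R]_N)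
    (x : 'rV[R]_d) : 'rV[R]_N :=
  \sum_i 'D_(delta_mx 0 i) (G i) x.

Fixpoint of_class (R : realType) (V W : normedModType R) (k : nat)
    (f : V -> W) : Prop :=
  match k with
  | 0 => continuous f
  | l.+1 => (forall x, differentiable f x) /\
            (forall v, of_class l (fun x => 'D_v f x))
  end.

Definition smooth (R : realType) (V W : normedModType R) (f : V -> W) : Prop :=
  forall k, of_class k f.

Record moving_mesh (R : realType) (d : nat) := MovingMesh {
  vertex : finType;
  cell : finType;
  node : cell -> 'I_d.+1 -> vertex;
  position : R -> vertex -> 'rV[R]_d;
  velocity : vertex -> 'rV[R]_d }.

Arguments position {R d} m _ _ : rename.

Definition cell_nodes (R : realType) d (M : moving_mesh R d) (K : cell M) :
  {set vertex M} := [set node K i | i : 'I_d.+1].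

Definition cell_vtx (R : realType) d (M : moving_mesh R d) (K : cell M) (t : R)
  (i : 'I_d.+1) : 'rV[R]_d := position M t (node K i).

Definition cell_set (R : realType) d (M : moving_mesh R d) (K : cell M) (t : R) :
  set 'rV[R]_d := simplex (cell_vtx K t).

Definition mesh_velocity (R : realType) d (M : moving_mesh R d) (K : cell M)
    (t : R) (x : 'rV[R]_d) : 'rV[R]_d :=
  bary_interp (cell_vtx K t) (fun i => velocity (node K i)) x.

Definition constant_velocities (R : realType) d (M : moving_mesh R d) (a b : R) :=
  forall t, a <= t <= b -> forall v : vertex M,
    position M t v = position M a v + (t - a) *: velocity v.

(* Distinct cells have distinct vertex sets, otherwise a cell could be
   duplicated. *)
Definition conforming_mesh (R : realType) d (M : moving_mesh R d) (t : R)
    (Omega : set 'rV[R]_d) : Prop :=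
  [/\ Omega = \bigcup_(K in [set: cell M]) cell_set K t,
      injective (@cell_nodes R d M) &
      forall K L : cell M, cell_set K t `&` cell_set L t =
        hull (cell_nodes K :&: cell_nodes L) (position M t)].

Definition positively_oriented (R : realType) d (M : moving_mesh R d) (t : R) :=
  forall K : cell M, 0 < \det (edge_mx (cell_vtx K t)).

(* Vertices of the face of [K] opposite to the [i]-th vertex of [K]. *)
Definition face_vtx (R : realType) d (M : moving_mesh R d.+1) (K : cell M)
    (i : 'I_d.+2) (t : R) (j : 'I_d.+1) : 'rV[R]_d.+1 :=
  cell_vtx K t (lift i j).

(* The cell on the other side of that face; [None] on the boundary. *)
Definition neighbour (R : realType) d (M : moving_mesh R d.+1) (K : cell M)
    (i : 'I_d.+2) : option (cell M) :=
  [pick L | (L != K) && (cell_nodes K :\ node K i \subset cell_nodes L)].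

(* Orthonormal modal basis of the polynomials of degree at most [k] on the
   reference simplex; [msize p <= k.+1] means that [p] has degree at most [k]. *)
Definition orthonormal_basis (R : realType) d k M (Khat : 'I_d.+1 -> 'rV[R]_d)
    (phihat : 'I_M.+1 -> mpoly d R) : Prop :=
  [/\ forall m, (msize (phihat m) <= k.+1)%N,
      forall p : mpoly d R, (msize p <= k.+1)%N ->
        exists! a : {ffun 'I_M.+1 -> R}, p = \sum_m a m *: phihat m,
      forall l m, vol_int (simplex Khat)
        (fun xi => meval (xi 0) (phihat l) * meval (xi 0) (phihat m)) =
        (l == m)%:R &
      exists2 c : R, c != 0 & phihat ord0 = mpolyC d c].

(* [bary_interp (cell_vtx K t) Khat] is the inverse of the affine map
   [xi |-> x(xi, t)] from the reference simplex onto K(t). *)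
Definition basis_fun (R : realType) d n (M : moving_mesh R d)
    (Khat : 'I_d.+1 -> 'rV[R]_d) (phihat : 'I_n.+1 -> mpoly d R)
    (K : cell M) (m : 'I_n.+1) (t : R) (x : 'rV[R]_d) : R :=
  meval (bary_interp (cell_vtx K t) Khat x 0) (phihat m).

Definition discrete_solution (R : realType) d N n (M : moving_mesh R d)
    (Khat : 'I_d.+1 -> 'rV[R]_d) (phihat : 'I_n.+1 -> mpoly d R)
    (coef : cell M -> 'I_n.+1 -> R -> 'rV[R]_N)
    (K : cell M) (t : R) (x : 'rV[R]_d) : 'rV[R]_N :=
  \sum_m basis_fun Khat phihat K m t x *: coef K m t.

(* The contraction of the ALE flux with the vector [v]. *)
Definition ale_flux (R : realType) d N
    (F : 'I_d -> 'rV[R]_d -> R -> 'rV[R]_N -> 'rV[R]_N)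
    (x : 'rV[R]_d) (t : R) (u : 'rV[R]_N) (w v : 'rV[R]_d) : 'rV[R]_N :=
  \sum_i v 0 i *: (F i x t u - w 0 i *: u).

Definition consistent_flux (R : realType) d N
    (F : 'I_d -> 'rV[R]_d -> R -> 'rV[R]_N -> 'rV[R]_N)
    (H : 'rV[R]_d -> R -> 'rV[R]_N -> 'rV[R]_N -> 'rV[R]_d -> 'rV[R]_d ->
         'rV[R]_N) : Prop :=
  forall x t u w nu, H x t u u w nu = ale_flux F x t u w nu.

(* A broken function is given by its values on each closed cell, which are its
   traces from inside the cell; [uext K i] is the exterior state on the boundary
   face [i] of [K]. *)
Definition outer_trace (R : realType) d N (M : moving_mesh R d.+1)
    (ut : cell M -> R -> 'rV[R]_d.+1 -> 'rV[R]_N)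
    (uext : cell M -> 'I_d.+2 -> R -> 'rV[R]_d.+1 -> 'rV[R]_N)
    (K : cell M) (i : 'I_d.+2) (t : R) (x : 'rV[R]_d.+1) : 'rV[R]_N :=
  if neighbour K i is Some L then ut L t x else uext K i t x.

Definition ale_dg_scheme (R : realType) d N n (M : moving_mesh R d.+1)
    (Khat : 'I_d.+2 -> 'rV[R]_d.+1) (phihat : 'I_n.+1 -> mpoly d.+1 R)
    (F : 'I_d.+1 -> 'rV[R]_d.+1 -> R -> 'rV[R]_N -> 'rV[R]_N)
    (H : 'rV[R]_d.+1 -> R -> 'rV[R]_N -> 'rV[R]_N -> 'rV[R]_d.+1 ->
         'rV[R]_d.+1 -> 'rV[R]_N)
    (nu : cell M -> 'I_d.+2 -> R -> 'rV[R]_d.+1)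
    (ut : cell M -> R -> 'rV[R]_d.+1 -> 'rV[R]_N)
    (uext : cell M -> 'I_d.+2 -> R -> 'rV[R]_d.+1 -> 'rV[R]_N)
    (u : cell M -> R -> 'rV[R]_d.+1 -> 'rV[R]_N) (tn tn1 : R) : Prop :=
  forall (K : cell M) (m : 'I_n.+1),
    let phi := basis_fun Khat phihat K m in
    vol_intv (cell_set K tn1) (fun x => phi tn1 x *: u K tn1 x) -
    vol_intv (cell_set K tn) (fun x => phi tn x *: u K tn x) =
    time_intv tn tn1 (fun t => vol_intv (cell_set K t) (fun x =>
      ale_flux F x t (ut K t x) (mesh_velocity K t x) (grad (phi t) x))) -
    time_intv tn tn1 (fun t => \sum_(i < d.+2)
      surf_intv (face_vtx K i t) (fun x => phi t x *:
        H x t (ut K t x) (outer_trace ut uext K i t x)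
          (mesh_velocity K t x) (nu K i t))).

(* Main.v *)
Require Import Defs.
From mathcomp Require Import all_boot all_order all_algebra perm ring.
From mathcomp Require Import -(notations) mpoly.
From mathcomp Require Import all_classical all_reals all_analysis measurable_realfun.
Import Order.TTheory GRing.Theory Num.Theory numFieldNormedType.Exports.
Local Open Scope classical_set_scope.
Local Open Scope ring_scope.

(** The predictor is the constant [c], and so are the exterior states, hence by
    consistency every numerical flux is the exact flux [F c - c w]. On a fixed
    simplex the divergence theorem ([simplex_divergence]) turns the boundary term
    into the volume term plus the integral of [phi_m] times the divergence of the
    flux. As [F c] is divergence free, only [- c phi_m (div w)] is left
    ([simplex_ale_identity]), and the mesh velocity [w], being affine, has
    constant divergence on the cell.

    The cell is the affine image of the standard simplex with Jacobian
    [J(t) = \det (E t)], where the edge matrix [E t] is affine in time. By the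
    formula of Jacobi ([deriv_det], [is_derive_det]) the product of [J] with the
    divergence of [w] is the derivative of [J]. The basis functions follow the
    motion, so the integral of [phi_m] over the cell is [J(t)] times a number that
    does not depend on time, and the right-hand side of the scheme integrates to
    [c] times the change of this integral ([moving_simplex_balance]). The new
    solution thus has the same moments as [c]. By orthonormality on the
    reference simplex these moments determine its coefficients, which are those
    of [c] ([orthonormal_basis_one]).

    The integrals are over row vectors, for a measure built as an iterated
    product. The change of variables by an invertible affine map
    ([ge0_change_unit], [vol_int_affine]) comes from block triangular
    factorization and Tonelli. The divergence theorem is reduced to derivatives
    along edges ([vol_int_derive_edge]): after relabelling the vertices, these are
    derivatives with respect to the first coordinate of the standard simplex
    ([std_int_deriv]). The two time integrals of the scheme are subtracted, so the
    volume term has to be integrable in time. Multiplied by the Jacobian, the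
    inverse of [E t] in its integrand becomes the adjugate; the integrand is then
    continuous in time and space, and Fubini applies
    ([std_int_integrable], [vol_flux_integrable]). *)

Set Implicit Arguments.
Unset Strict Implicit.
Unset Printing Implicit Defensive.

(** * Borel sets of row vectors *)

Definition tuple_of_row (R : realType) n (v : 'rV[R]_n) : n.-tuple R :=
  [tuple v 0 i | i < n].

Lemma tuple_of_rowK (R : realType) n :
  cancel (@tuple_of_row R n) (@row_of_tuple R n).
Proof. by move=> v; apply/rowP => i; rewrite mxE tnth_mktuple. Qed.

Lemma row_of_tuple_cons (R : realType) n (x : R) (y : n.-tuple R) :
  row_of_tuple (tuple_cons (x, y)) =
  row_mx x%:M (row_of_tuple y) :> 'rV[R]_(1 + n).
Proof.
apply/rowP => i; have [j ->|j ->] := split_ordP i.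
  by rewrite row_mxEl ord1 !mxE eqxx mulr1n (tnth_nth x).
by rewrite row_mxEr !mxE !(tnth_nth x).
Qed.

(** The Borel sets of ['rV_n], seen through the measurable space of tuples on
    which the measure lives. *)
Definition rmeasurable (R : realType) n (D : set 'rV[R]_n) : Prop :=
  measurable (@row_of_tuple R n @^-1` D : set (n.-tuple (measurableTypeR R))).

Definition rmeasurable_fun (R : realType) n (d : measure_display)
    (T : measurableType d) (f : 'rV[R]_n -> T) : Prop :=
  measurable_fun [set: n.-tuple (measurableTypeR R)] (f \o @row_of_tuple R n).

Lemma rmeasurable_coord (R : realType) n i :
  rmeasurable_fun (fun x : 'rV[R]_n => x 0 i : measurableTypeR R).
Proof.
rewrite /rmeasurable_fun (_ : _ \o _ = fun t => tnth t i); last first.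
  by apply/funext => t /=; rewrite mxE.
exact: measurable_tnth.
Qed.

Lemma rmeasurable_ball (R : realType) n (q : 'rV[R]_n) e : 0 < e ->
  rmeasurable (ball q e).
Proof.
move=> e0; rewrite /rmeasurable.
have -> : @row_of_tuple R n @^-1` ball q e =
    \bigcap_(i in [set: 'I_n])
      (fun x => row_of_tuple x 0 i) @^-1` ball (q 0 i) e.
  apply/seteqP; split => t /=; first by move=> h i _; exact: h.2.
  by move=> h; split => // i j; rewrite ord1; exact: h.
apply: fin_bigcap_measurable; first exact: finite_finset.
move=> i _; rewrite -[X in measurable X]setTI.
apply: rmeasurable_coord => //.
by apply: open_measurable; exact: ball_open.
Qed.

(** The product sigma-algebra contains the balls of the sup norm, and an open
    set is a countable union of balls with rational centre and radius. *)
Lemma open_rmeasurable (R : realType) n (U : set 'rV[R]_n) :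
  open U -> rmeasurable U.
Proof.
move=> oU; rewrite /rmeasurable.
pose q (c : {ffun 'I_n -> rat} * nat) := (\row_i ratr (c.1 i)) : 'rV[R]_n.
pose e (c : {ffun 'I_n -> rat} * nat) := (c.2.+1%:R)^-1 : R.
pose B c := if `[< ball (q c) (e c) `<=` U >] then ball (q c) (e c) else set0.
have -> : U = \bigcup_c B c.
  apply/seteqP; split => x.
    move=> Ux; have : nbhs x U by rewrite nbhsE; exists U.
    move=> /nbhs_ballP[r /= r0 rU].
    have [k kr] : exists k, (k.+1%:R)^-1 < r / 2 :> R.
      have r20 : 0 < r / 2 by rewrite divr_gt0.
      have /ltr_add_invr[k] := r20; rewrite add0r => kr; exists k; exact: kr.
    have h i : exists p : rat, `|ratr p - x 0 i| < (k.+1%:R)^-1.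
      have : x 0 i - (k.+1%:R)^-1 < x 0 i + (k.+1%:R)^-1.
        by rewrite ltrBlDr -addrA ltrDl addr_gt0.
      move=> /rat_in_itvoo[p]; rewrite in_itv/= => /andP[p1 p2]; exists p.
      by rewrite ltr_distl p1.
    have /choice[p hp] := h.
    exists ([ffun i => p i], k) => //; rewrite /B.
    have qx : ball (q ([ffun i => p i], k)) (k.+1%:R)^-1 x.
      split; first by rewrite invr_gt0.
      by move=> i j; rewrite ord1 /ball/= mxE ffunE.
    rewrite ifT//; apply/asboolP => y qy; apply: rU.
    apply: (@le_ball _ _ _ ((k.+1%:R)^-1 + (k.+1%:R)^-1)).
      by rewrite (splitr r) lerD// ltW.
    apply: ball_triangle qy; exact: ball_sym.
  by move=> [c _]; rewrite /B; case: ifP => // /asboolP; exact.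
rewrite preimage_bigcup; apply: countable_bigcupT_measurable => //.
move=> c; rewrite /B; case: ifP => _; last by rewrite preimage_set0.
by apply: rmeasurable_ball; rewrite /e invr_gt0.
Qed.

Lemma continuous_rmeasurable (R : realType) n (f : 'rV[R]_n -> R) :
  continuous f -> rmeasurable_fun (f : 'rV[R]_n -> measurableTypeR R).
Proof.
move=> cf; rewrite /rmeasurable_fun.
apply: (measurability _ (RGenOpens.measurableE R)) => //.
move=> _ [_ [a [b ->] <-]]; rewrite setTI comp_preimage.
apply: open_rmeasurable; apply: open_comp; last exact: interval_open.
by move=> x _; exact: cf.
Qed.

Lemma measurable_tuple_affine (R : realType) n m (A : 'M[R]_(n, m)) b :
  measurable_fun [set: n.-tuple (measurableTypeR R)]
    (fun x => tuple_of_row (row_of_tuple x *m A + b) :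
      m.-tuple (measurableTypeR R)).
Proof.
apply/measurable_fun_tnthP => i.
rewrite (_ : _ \o _ = (fun y : 'rV_n => (y *m A + b) 0 i) \o @row_of_tuple R n);
  last by apply/funext => x /=; rewrite tnth_mktuple.
rewrite [X in X \o _](_ : _ = fun y : 'rV_n => (\sum_j y 0 j * A j i) + b 0 i);
  last by apply/funext => y; rewrite !mxE.
apply: measurable_funD => //; apply: measurable_sum => j.
by apply: measurable_funM => //; exact: rmeasurable_coord.
Qed.

Lemma rmeasurable_affine (R : realType) n m (d : measure_display)
    (T : measurableType d) (f : 'rV[R]_m -> T) (A : 'M[R]_(n, m)) b :
  rmeasurable_fun f -> rmeasurable_fun (fun x => f (x *m A + b)).
Proof.
move=> mf; have := measurableT_comp mf (measurable_tuple_affine A b).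
rewrite /rmeasurable_fun; congr measurable_fun.
by apply/funext => x /=; rewrite tuple_of_rowK.
Qed.

Lemma rmeasurable_preimage_affine (R : realType) n m (D : set 'rV[R]_m)
    (A : 'M[R]_(n, m)) b :
  rmeasurable D -> rmeasurable [set x | D (x *m A + b)].
Proof.
move=> mD; have := measurable_tuple_affine A b measurableT mD.
rewrite setTI /rmeasurable; congr measurable.
by apply/seteqP; split => x /=; rewrite tuple_of_rowK.
Qed.

(** * Lebesgue measure and affine maps *)

(** Both sides are integrals of [f], against two measures that agree on
    half-open intervals. *)
Lemma ge0_integral_affine1 (R : realType) (a b : R)
    (f : measurableTypeR R -> \bar R) :
  a != 0 -> measurable_fun setT f -> (forall x, (0 <= f x)%E) ->
  (`|a|%:E * \int[lebesgue_measure]_x f ((x : R) * a + b)%R =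
   \int[lebesgue_measure]_x f x)%E.
Proof.
move=> a0 mf f0; pose phi (x : measurableTypeR R) : measurableTypeR R := x * a + b.
have mphi : measurable_fun setT phi.
  by apply: measurable_funD => //; apply: measurable_funM.
pose pm : {measure set (measurableTypeR R) -> \bar R} :=
  measure_function_pushforward__canonical__measure_function_Measure
    (@lebesgue_measure R) mphi.
pose m := mscale (NngNum (normr_ge0 a)) pm.
have mE A : measurable A -> lebesgue_measure A = m A.
  move=> mA; apply: lebesgue_measure_unique mA => _ [[u v] _ <-]; rewrite [(u, v).1]/= [(u, v).2]/=.
  pose I := if 0 < a then `](u - b) / a, (v - b) / a]%classic
    else `[(v - b) / a, (u - b) / a[%classic.
  have pre : phi @^-1` `]u, v]%classic = I.
    apply/seteqP; split => x; rewrite /phi/I/=; case: ltgtP a0 => // a0 _;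
    by rewrite /= !in_itv/= ?(ltr_pdivrMr, ler_pdivlMr, ltr_ndivlMr, ler_ndivrMr)//
      ?ltrBlDr ?lerBrDr // andbC.
  transitivity ((`|a|%R)%:E * lebesgue_measure I)%E; last by rewrite -pre.
  rewrite /I lebesgue_measure_itv/= lte_fin.
  case: (ltgtP 0 a) a0 => // a0 _; rewrite ?eqxx//; rewrite lebesgue_measure_itv/= lte_fin.
    rewrite ltr_pM2r ?invr_gt0// ltrD2r; case: ifP => _; rewrite ?mule0//.
    rewrite -!EFinB -EFinM gtr0_norm//; congr EFin; field; exact: lt0r_neq0.
  rewrite ltr_nM2r ?invr_lt0// ltrD2r; case: ifP => _; rewrite ?mule0//.
  rewrite -!EFinB -EFinM ltr0_norm//; congr EFin; field; exact: ltr0_neq0.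
rewrite [RHS](eq_measure_integral m); last by move=> A mA _; exact: mE.
rewrite ge0_integral_mscale// /pm/= ge0_integral_pushforward//.
Qed.

Lemma measurable_tuple_pair (R : realType) n d (T : measurableType d)
    (f : 'rV[R]_(1 + n) -> T) : rmeasurable_fun f ->
  measurable_fun setT (fun p : measurableTypeR R * n.-tuple (measurableTypeR R) =>
    f (row_mx (p.1 : R)%:M (row_of_tuple p.2))).
Proof.
move=> mf.
rewrite (_ : (fun _ => _) = (f \o @row_of_tuple R n.+1) \o
    @tuple_cons (measurableTypeR R) n).
  by apply: measurableT_comp => //; exact: measurable_tuple_cons.
by apply/funext => -[x y] /=; rewrite row_of_tuple_cons.
Qed.

Section tonelli.
Local Open Scope ereal_scope.

Lemma lebesgue_tuple_tonelli (R : realType) n (f : 'rV[R]_(1 + n) -> \bar R) :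
  rmeasurable_fun f -> (forall x, 0 <= f x) ->
  \int[lebesgue_tuple R n.+1]_y f (row_of_tuple y) =
  \int[lebesgue_measure]_x \int[lebesgue_tuple R n]_y
    f (row_mx (x : R)%:M (row_of_tuple y)).
Proof.
move=> mf f0.
have mc := @measurable_tuple_cons _ (measurableTypeR R) n.
pose m : {measure set (n.+1.-tuple (measurableTypeR R)) -> \bar R} :=
  measure_function_pushforward__canonical__measure_function_Measure
    (@lebesgue_measure R \x lebesgue_tuple R n) mc.
rewrite (eq_measure_integral m); last by [].
rewrite (ge0_integral_pushforward mc _ measurableT mf); last first.
  by move=> y _; exact: f0.
rewrite preimage_setT.
have mfc := measurableT_comp mf mc.
rewrite (fubini_tonelli1 _ mfc); last by move=> p; exact: f0.
apply: eq_integral => x _; rewrite /fubini_F.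
by apply: eq_integral => y _; rewrite [LHS]/= row_of_tuple_cons.
Qed.

Lemma lebesgue_tuple_tonelli2 (R : realType) n (f : 'rV[R]_(1 + n) -> \bar R) :
  rmeasurable_fun f -> (forall x, 0 <= f x) ->
  \int[lebesgue_tuple R n.+1]_y f (row_of_tuple y) =
  \int[lebesgue_tuple R n]_y \int[lebesgue_measure]_x
    f (row_mx (x : R)%:M (row_of_tuple y)).
Proof.
move=> mf f0; rewrite lebesgue_tuple_tonelli//.
apply: (fubini_tonelli (fun p : measurableTypeR R * n.-tuple (measurableTypeR R) =>
    f (row_mx (p.1 : R)%:M (row_of_tuple p.2)))) => //.
exact: measurable_tuple_pair.
Qed.

End tonelli.

Definition ge0_change_of_variables (R : realType) n (A : 'M[R]_n) (b : 'rV[R]_n) :=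
  forall f : 'rV[R]_n -> \bar R, rmeasurable_fun f -> (forall x, 0 <= f x)%E ->
  (`|\det A|%:E * \int[lebesgue_tuple R n]_y f (row_of_tuple y *m A + b)%R =
   \int[lebesgue_tuple R n]_y f (row_of_tuple y))%E.

Lemma ge0_change_comp (R : realType) n (A B : 'M[R]_n) (a b : 'rV[R]_n) :
  ge0_change_of_variables A a -> ge0_change_of_variables B b ->
  ge0_change_of_variables (A *m B) (a *m B + b).
Proof.
move=> hA hB f mf f0; rewrite det_mulmx normrM mulrC EFinM -muleA.
rewrite -hB//; congr (_ * _)%E.
rewrite -(hA (fun z => f (z *m B + b)%R)); last 2 first.
- exact: (rmeasurable_affine _ _ mf).
- by move=> x; exact: f0.
congr (_ * _)%E; apply: eq_integral => y _.
by rewrite mulmxDl mulmxA addrA.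
Qed.

Lemma measurable_partial_integral (R : realType) n (f : 'rV[R]_(1 + n) -> \bar R) :
  rmeasurable_fun f -> (forall x, 0 <= f x)%E ->
  measurable_fun setT (fun x : measurableTypeR R =>
    \int[lebesgue_tuple R n]_y f (row_mx (x : R)%:M (row_of_tuple y)))%E.
Proof.
move=> mf f0.
have := @measurable_fun_fubini_tonelli_F _ _ _ _ _ (lebesgue_tuple R n)
  (fun p : measurableTypeR R * n.-tuple (measurableTypeR R) =>
    f (row_mx (p.1 : R)%:M (row_of_tuple p.2))).
apply; first exact: measurable_tuple_pair.
by move=> p; exact: f0.
Qed.

(** Integrate in the last [n] variables first: the first one only shifts them. *)
Lemma ge0_change_ublock (R : realType) n (a : R) (r : 'rV[R]_n) (B : 'M[R]_n) b :
  (forall b, ge0_change_of_variables B b) -> a != 0%R ->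
  ge0_change_of_variables (block_mx a%:M r 0 B : 'M[R]_(1 + n)) b.
Proof.
move=> hB a0 f mf f0.
pose b0 := lsubmx (b : 'rV[R]_(1 + n)) 0 0; pose b' := rsubmx (b : 'rV[R]_(1 + n)).
have bE : b = row_mx b0%:M b' :> 'rV_(1 + n).
  by rewrite /b0 /b' -mx11_scalar hsubmxK.
rewrite det_ublock det_scalar1 normrM EFinM.
rewrite (@lebesgue_tuple_tonelli R n (fun z => f (z *m _ + _))); last 2 first.
- exact: (rmeasurable_affine _ _ mf).
- by move=> x; exact: f0.
rewrite [RHS](lebesgue_tuple_tonelli mf f0).
rewrite -[RHS](ge0_integral_affine1 b0 a0); last 2 first.
- exact: measurable_partial_integral.
- by move=> x; apply: integral_ge0 => y _.
rewrite -muleA -ge0_integralZl_EFin//; last 2 first.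
- by move=> x _; apply: integral_ge0 => y _.
- apply: (@measurable_partial_integral R n (fun z => f (z *m _ + _))) => //.
  exact: (rmeasurable_affine _ _ mf).
congr (_ * _)%E; apply: eq_integral => x _.
pose fx z := f (row_mx ((x : R) * a + b0)%:M z).
have mfx : rmeasurable_fun fx.
  rewrite /rmeasurable_fun.
  rewrite (_ : _ \o _ = (fun p => f (row_mx (p.1 : R)%:M (row_of_tuple p.2))) \o
     (fun y => ((x : R) * a + b0, y)%R)); last exact/funext.
  exact: (measurableT_comp (measurable_tuple_pair mf) (pair1_measurable _)).
rewrite -[RHS](hB (x *: r + b') fx)//; last by move=> z; exact: f0.
congr (_ * _)%E; apply: eq_integral => y _; congr f.
rewrite mul_row_block mulmx0 addr0 bE add_row_mx -scalar_mxM -raddfD/=.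
by rewrite mul_scalar_mx addrCA addrA.
Qed.

(** Integrate in the first variable first: the others only translate it. *)
Lemma ge0_change_shear (R : realType) n (c : 'cV[R]_n) :
  ge0_change_of_variables (block_mx 1%:M 0 c 1%:M : 'M[R]_(1 + n)) 0.
Proof.
move=> f mf f0; rewrite det_lblock !det1 mulr1 normr1 mul1e.
rewrite (@lebesgue_tuple_tonelli2 R n (fun z => f (z *m _ + _))); last 2 first.
- exact: (rmeasurable_affine _ _ mf).
- by move=> x; exact: f0.
rewrite [RHS](lebesgue_tuple_tonelli2 mf f0).
apply: eq_integral => y _.
have mfy : measurable_fun setT (fun x : measurableTypeR R =>
    f (row_mx (x : R)%:M (row_of_tuple y))).
  rewrite (_ : (fun _ => _) = (fun p => f (row_mx (p.1 : R)%:M (row_of_tuple p.2))) \o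
     (fun x => (x, y))); last exact/funext.
  exact: (measurableT_comp (measurable_tuple_pair mf) (pair2_measurable _)).
rewrite -[RHS](ge0_integral_affine1 ((row_of_tuple y *m c) 0 0) (oner_neq0 R))//.
rewrite normr1 mul1e; apply: eq_integral => x _; congr f.
rewrite mul_row_block addr0 mulmx0 add0r !mulmx1 mulr1.
by rewrite raddfD/= -mx11_scalar.
Qed.

(** Every invertible matrix is a product of block triangular ones, by one step
    of Gaussian elimination and induction on the size. *)
Lemma ge0_change_unit (R : realType) n (A : 'M[R]_n) b :
  A \in unitmx -> ge0_change_of_variables A b.
Proof.
elim: n => [|n IH] in A b *.
  move=> _ f mf f0; rewrite det_mx00 normr1 mul1e.
  by apply: eq_integral => y _; congr f; apply/rowP => -[].
have IU a (r : 'rV[R]_n) (B : 'M[R]_n) c : a != 0%R -> B \in unitmx ->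
    ge0_change_of_variables (block_mx a%:M r 0 B : 'M[R]_(1 + n)) c.
  by move=> a0 uB; apply: ge0_change_ublock => // b'; exact: IH.
(* a block LU factorization, once the corner entry is nonzero *)
have step (M : 'M[R]_(1 + n)) c : M \in unitmx -> ulsubmx M 0 0 != 0%R ->
    ge0_change_of_variables (M : 'M[R]_n.+1) c.
  set a := ulsubmx M 0 0 => uM a0.
  pose L : 'M[R]_(1 + n) := block_mx 1%:M 0 (a^-1 *: dlsubmx M) 1%:M.
  pose U : 'M[R]_(1 + n) := block_mx a%:M (ursubmx M) 0
    (drsubmx M - (a^-1 *: dlsubmx M) *m ursubmx M).
  have ME : M = L *m U.
    rewrite /L /U mulmx_block !mul1mx !mul0mx !addr0 -[LHS]submxK.
    rewrite (mx11_scalar (ulsubmx M)) -/a; congr block_mx.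
      by rewrite mul_mx_scalar scalerA divff// scale1r.
    by rewrite addrC subrK.
  have uU : U \in unitmx by move: uM; rewrite ME unitmx_mul => /andP[].
  rewrite -[c]add0r -(mul0mx _ U) ME.
  apply: (@ge0_change_comp R n.+1); first exact: ge0_change_shear.
  apply: IU => //; move: uU; rewrite !unitmxE det_ublock det_scalar1 unitrM.
  by case/andP.
move=> uA; pose M : 'M[R]_(1 + n) := A.
have [a0|a0] := eqVneq (ulsubmx M 0 0) 0%R; last exact: step.
(* otherwise a shear brings a nonzero entry of the first column to the corner *)
have [i ci] : exists i, dlsubmx M i 0 != 0%R.
  apply/existsP; apply: contraT; rewrite negb_exists => /forallP h.
  move: uA; rewrite unitmxE (_ : A = (block_mx (0 : 'M[R]_1) (ursubmx M) 0 (drsubmx M) : 'M[R]_(1 + n))).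
    by rewrite (@det_ublock R 1 n) det_mx11 mxE mul0r unitr0.
  rewrite -[LHS](submxK M); have -> : ulsubmx M = 0.
    by apply/matrixP => j k; rewrite !ord1 a0 mxE.
  suff -> : dlsubmx M = 0 by [].
  by apply/matrixP => j k; rewrite ord1 [RHS]mxE; apply/eqP; rewrite -[_ == _]negbK h.
pose S s : 'M[R]_(1 + n) := block_mx 1%:M (s *: delta_mx 0 i) 0 1%:M.
have SS : S (-1)%R *m S 1%R = 1%:M.
  rewrite /S mulmx_block !mul1mx !mulmx0 !mul0mx !mulmx1 !addr0 add0r.
  by rewrite scale1r scaleN1r subrr -scalar_mx_block.
have uS s : S s \in unitmx by rewrite unitmxE det_ublock !det1 mulr1 unitr1.
rewrite (_ : A = S (-1)%R *m (S 1%R *m M)); last by rewrite mulmxA SS mul1mx.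
rewrite -[b]add0r -(mul0mx _ (S 1%R *m M)).
apply: (@ge0_change_comp R n.+1); first by apply: IU; rewrite ?oner_neq0 ?unitmx1.
apply: step; first by rewrite unitmx_mul uS.
rewrite -[M]submxK /S mulmx_block block_mxKul mul1mx scale1r mxE a0 add0r.
by rewrite -rowE mxE.
Qed.


(** * Integrals over simplices *)

Lemma fine_mul_pos (R : realType) (a : R) (x : \bar R) : 0 < a ->
  fine (a%:E * x)%E = a * fine x.
Proof.
move=> a0; case: x => [x||] //=.
  by rewrite gt0_muley ?lte_fin// mulr0.
by rewrite gt0_muleNy ?lte_fin// mulr0.
Qed.

Lemma rmeasurable_patch (R : realType) n (D : set 'rV[R]_n) (f : 'rV[R]_n -> R) :
  rmeasurable D -> rmeasurable_fun (f : 'rV[R]_n -> measurableTypeR R) ->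
  rmeasurable_fun ((EFin \o f) \_ D).
Proof.
move=> mD mf; rewrite /rmeasurable_fun.
rewrite (_ : _ \o _ = (EFin \o (f \o @row_of_tuple R n)) \_ (@row_of_tuple R n @^-1` D)); last first.
  by apply/funext => y /=; rewrite !patchE.
apply/(measurable_restrictT _ mD)/measurable_EFinP.
exact: measurable_funS mf.
Qed.

Lemma vol_int_patch (R : realType) n (D : set 'rV[R]_n) (f : 'rV[R]_n -> R) :
  vol_int D f = fine (\int[lebesgue_tuple R n]_y ((EFin \o f) \_ D) (row_of_tuple y)).
Proof.
rewrite /vol_int /Rintegral integral_mkcond; congr fine.
Qed.

Lemma eq_vol_int (R : realType) n (D : set 'rV[R]_n) (f g : 'rV[R]_n -> R) :
  (forall x, D x -> f x = g x) -> vol_int D f = vol_int D g.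
Proof. by move=> fg; apply: eq_Rintegral => y; rewrite inE => /fg. Qed.

(** The positive and the negative parts of [f], extended by zero outside [D],
    are transformed separately. The positive factor commutes with their
    difference and with [fine], even on infinite values. *)
Lemma vol_int_affine (R : realType) n (D : set 'rV[R]_n) (f : 'rV[R]_n -> R)
    (A : 'M[R]_n) (b : 'rV[R]_n) :
  rmeasurable D -> rmeasurable_fun (f : 'rV[R]_n -> measurableTypeR R) ->
  A \in unitmx ->
  vol_int D f =
  `|\det A| * vol_int [set y | D (y *m A + b)] (fun y => f (y *m A + b)).
Proof.
move=> mD mf uA; rewrite !vol_int_patch.
have dA : 0 < `|\det A| by rewrite normr_gt0 -unitfE -unitmxE.
rewrite -(fine_mul_pos _ dA); congr fine.
pose g := (EFin \o f) \_ D.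
have mg : rmeasurable_fun g by exact: rmeasurable_patch.
have mgp : rmeasurable_fun (g^\+)%E by rewrite /rmeasurable_fun -funepos_comp; exact: measurable_funepos.
have mgn : rmeasurable_fun (g^\-)%E by rewrite /rmeasurable_fun -funeneg_comp; exact: measurable_funeneg.
have gE y : ((EFin \o (fun y => f (y *m A + b))) \_ [set y | D (y *m A + b)]) y =
    g (y *m A + b) by rewrite /g !patchE /=; congr (if _ then _ else _).
under [in RHS]eq_integral do rewrite gE.
have iE (h : 'rV[R]_n -> \bar R) : (\int[lebesgue_tuple R n]_y h (row_of_tuple y) =
    \int[lebesgue_tuple R n]_y h^\+ (row_of_tuple y) -
    \int[lebesgue_tuple R n]_y h^\- (row_of_tuple y))%E.
  have := integralE (lebesgue_tuple R n) setT (h \o @row_of_tuple R n).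
  by rewrite funepos_comp funeneg_comp; exact.
transitivity (`|\det A|%:E *
  (\int[lebesgue_tuple R n]_y g^\+ (row_of_tuple y *m A + b)%R -
   \int[lebesgue_tuple R n]_y g^\- (row_of_tuple y *m A + b)%R))%E; last first.
  by congr (_ * _)%E; rewrite (iE (g \o (fun z => z *m A + b))) funepos_comp funeneg_comp.
rewrite -/g iE.
rewrite -(ge0_change_unit b uA mgp (fun x => funepos_ge0 _ _)).
rewrite -(ge0_change_unit b uA mgn (fun x => funeneg_ge0 _ _)).
have : (0 <= \int[lebesgue_tuple R n]_y (g^\+)%E (row_of_tuple y *m A + b)%R)%E.
  by apply: integral_ge0 => y _; exact: funepos_ge0.
have : (0 <= \int[lebesgue_tuple R n]_y (g^\-)%E (row_of_tuple y *m A + b)%R)%E.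
  by apply: integral_ge0 => y _; exact: funeneg_ge0.
move: (integral _ _ _) => u; move: (integral _ _ _) => v.
case: u v => [u||] [v||] // _ _.
- exact: (congr1 EFin (esym (mulrBr _ _ _))).
- by rewrite !gt0_muley ?lte_fin.
- by rewrite gt0_muley ?lte_fin//= gt0_muleNy ?lte_fin.
- by rewrite gt0_muley ?lte_fin//= gt0_muleNy ?lte_fin.
Qed.

Lemma std_simplex_rmeasurable (R : realType) n : rmeasurable (@std_simplex R n).
Proof.
rewrite /rmeasurable /std_simplex.
have -> : @row_of_tuple R n @^-1` [set y | (forall i, 0 <= y 0 i) /\ \sum_i y 0 i <= 1] =
    (\bigcap_(i in [set: 'I_n])
      (fun x => row_of_tuple x 0 i) @^-1` `[0, +oo[%classic) `&`
    (fun x => \sum_i row_of_tuple x 0 i) @^-1` `]-oo, 1]%classic.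
  apply/seteqP; split => t /=.
    by move=> [h1 h2]; split=> [i _|] /=; rewrite in_itv//= ?andbT; exact: h1.
  move=> [h1]; rewrite in_itv/= => h2; split => // i.
  by have := h1 i I; rewrite /= in_itv/= andbT.
apply: measurableI.
  apply: fin_bigcap_measurable; first exact: finite_finset.
  move=> i _; rewrite -[X in measurable X]setTI.
  by apply: rmeasurable_coord.
rewrite -[X in measurable X]setTI.
apply: measurable_sum => // i; exact: rmeasurable_coord.
Qed.

Definition cube (R : realType) n (u v : R) : set 'rV[R]_n :=
  [set y | forall i, `[u, v]%classic (y 0 i)].

Lemma cube_compact (R : realType) n (u v : R) : compact (@cube R n u v).
Proof. by apply: (@rV_compact R n (fun=> `[u, v]%classic)) => i; exact: segment_compact. Qed.

Lemma cube_rmeasurable (R : realType) n (u v : R) : rmeasurable (@cube R n u v).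
Proof.
rewrite /rmeasurable.
have -> : @row_of_tuple R n @^-1` cube u v =
  (\bigcap_(i in [set: 'I_n])
    (fun x => row_of_tuple x 0 i) @^-1` `[u, v]%classic).
  apply/seteqP; split => t /=; first by move=> h i _; exact: h.
  by move=> h i; exact: h.
apply: fin_bigcap_measurable; first exact: finite_finset.
move=> i _; rewrite -[X in measurable X]setTI.
by apply: rmeasurable_coord.
Qed.

Lemma lebesgue_tuple_cube (R : realType) n (u v : R) :
  (lebesgue_tuple R n (@row_of_tuple R n @^-1` cube u v) < +oo)%E.
Proof.
elim: n => [|n IH].
  by rewrite /= diracE mem_set ?ltry// => -[].
rewrite /= /lebesgue_cons /pushforward.
have -> : tuple_cons (n:=n) @^-1` (@row_of_tuple R n.+1 @^-1` cube u v) =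
    `[u, v]%classic `*` (@row_of_tuple R n @^-1` cube u v).
  apply/seteqP; split => -[x y] /=.
    move=> h; split=> [|i]; first by have := h ord0; rewrite mxE.
    by have := h (lift ord0 i); rewrite !mxE tnthS.
  move=> [hx hy] i; rewrite mxE; have [j ->|->] := unliftP ord0 i.
    by rewrite tnthS; have := hy j; rewrite mxE.
  by rewrite tnth0.
rewrite product_measure1E//; last exact: cube_rmeasurable.
apply: lte_mul_pinfty => //; rewrite ge0_fin_numE//.
rewrite [X in (X < _)%E](_ : _ =
  (if (u%:E < v%:E) then v%:E - u%:E else 0)%E); last exact: lebesgue_measure_itv.
by case: ifP => _; rewrite -?EFinB ltry.
Qed.

Lemma continuous_integrable (R : realType) n (D : set 'rV[R]_n) (u v : R)
    (f : 'rV[R]_n -> R) :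
  rmeasurable D -> D `<=` cube u v -> continuous f ->
  (lebesgue_tuple R n).-integrable (@row_of_tuple R n @^-1` D)
    (EFin \o (f \o @row_of_tuple R n)).
Proof.
move=> mD Duv cf; apply: measurable_bounded_integrable => //.
- apply: le_lt_trans (lebesgue_tuple_cube n u v); apply: le_measure.
  + by rewrite inE.
  + by rewrite inE; exact: cube_rmeasurable.
  + by move=> y; exact: Duv.
- exact: measurable_funS (continuous_rmeasurable cf).
- have : compact (f @` cube u v).
    apply: continuous_compact; last exact: cube_compact.
    exact: continuous_subspaceT.
  move=> /compact_bounded[M [Mr hM]]; exists M; split => // x Mx y Dy.
  by apply: (hM x Mx); exists (row_of_tuple y) => //; exact: Duv.
Qed.

Lemma std_simplex_cube (R : realType) n : @std_simplex R n `<=` cube 0 1.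
Proof.
move=> y [y0 y1] i /=; rewrite in_itv/= y0/=; apply: le_trans y1.
by rewrite (bigD1 i)//= lerDl sumr_ge0.
Qed.

Definition std_int (R : realType) n (f : 'rV[R]_n -> R) : R :=
  vol_int (@std_simplex R n) f.

Lemma continuous_std_integrable (R : realType) n (f : 'rV[R]_n -> R) :
  continuous f ->
  (lebesgue_tuple R n).-integrable (@row_of_tuple R n @^-1` @std_simplex R n)
    (EFin \o (f \o @row_of_tuple R n)).
Proof.
apply: continuous_integrable; first exact: std_simplex_rmeasurable.
exact: std_simplex_cube.
Qed.

Lemma std_intD (R : realType) n (f g : 'rV[R]_n -> R) :
  continuous f -> continuous g ->
  std_int (fun x => f x + g x) = std_int f + std_int g.
Proof.
move=> cf cg; apply: RintegralD; first exact: std_simplex_rmeasurable.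
  exact: continuous_std_integrable.
exact: continuous_std_integrable.
Qed.

Lemma std_intZ (R : realType) n (a : R) (f : 'rV[R]_n -> R) :
  continuous f -> std_int (fun x => a * f x) = a * std_int f.
Proof.
move=> cf; apply: RintegralZl; first exact: std_simplex_rmeasurable.
exact: continuous_std_integrable.
Qed.

Lemma std_intB (R : realType) n (f g : 'rV[R]_n -> R) :
  continuous f -> continuous g ->
  std_int (fun x => f x - g x) = std_int f - std_int g.
Proof.
move=> cf cg; apply: RintegralB; first exact: std_simplex_rmeasurable.
  exact: continuous_std_integrable.
exact: continuous_std_integrable.
Qed.

Lemma continuous_sum (R : realType) (T : topologicalType) I (r : seq I)
    (f : I -> T -> R) :
  (forall i, continuous (f i)) -> continuous (fun x => \sum_(i <- r) f i x).
Proof.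
move=> cf; elim: r => [|i r IH] x.
  by under eq_fun do rewrite big_nil; exact: cvg_cst.
under eq_fun do rewrite big_cons.
by apply: cvgD; [exact: cf|exact: IH].
Qed.

Lemma std_int_sum (R : realType) n I (r : seq I) (f : I -> 'rV[R]_n -> R) :
  (forall i, continuous (f i)) ->
  std_int (fun x => \sum_(i <- r) f i x) = \sum_(i <- r) std_int (f i).
Proof.
move=> cf; elim: r => [|i r IH].
  have c0 : continuous (cst 0 : 'rV[R]_n -> R) by move=> x; exact: cst_continuous.
  rewrite big_nil -[RHS](subrr (std_int (cst 0 : 'rV[R]_n -> R))) -std_intB//.
  by congr std_int; apply/funext => x; rewrite big_nil subrr.
rewrite big_cons -IH -std_intD//; last exact: continuous_sum.
by congr std_int; apply/funext => x; rewrite big_cons.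
Qed.

(** * Affine parametrizations of simplices *)

Definition param (R : realType) n d (Q : 'I_n.+1 -> 'rV[R]_d) (y : 'rV[R]_n) :
  'rV[R]_d := Q ord0 + y *m edge_mx Q.

(** Barycentric coordinates of [param Q y] with respect to [Q]; the coordinate
    of index [ord0] is the slack of the others. *)
Definition bary_coord (R : realType) n (y : 'rV[R]_n) (i : 'I_n.+1) : R :=
  if unlift ord0 i is Some j then y 0 j else 1 - \sum_j y 0 j.

Lemma bary_coord0 (R : realType) n (y : 'rV[R]_n) :
  bary_coord y ord0 = 1 - \sum_j y 0 j.
Proof. by rewrite /bary_coord unlift_none. Qed.

Lemma bary_coordS (R : realType) n (y : 'rV[R]_n) j :
  bary_coord y (lift ord0 j) = y 0 j.
Proof. by rewrite /bary_coord liftK. Qed.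

Lemma sum_bary_coord (R : realType) n (y : 'rV[R]_n) : \sum_i bary_coord y i = 1.
Proof.
rewrite big_ord_recl bary_coord0.
by under [X in _ + X]eq_bigr do rewrite bary_coordS; rewrite subrK.
Qed.

Lemma param_comb (R : realType) n d (Q : 'I_n.+1 -> 'rV[R]_d) (a : 'I_n.+1 -> R) :
  \sum_i a i = 1 ->
  \sum_i a i *: Q i = param Q (\row_j a (lift ord0 j)).
Proof.
move=> a1; rewrite /param mulmx_sum_row big_ord_recl.
have -> : a ord0 = 1 - \sum_j a (lift ord0 j).
  by move: a1; rewrite big_ord_recl => <-; rewrite addrK.
rewrite scalerBl scale1r -addrA; congr (_ + _).
rewrite addrC scaler_suml -sumrB; apply: eq_bigr => j _.
by rewrite mxE rowK scalerBr.
Qed.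

Lemma paramE (R : realType) n d (Q : 'I_n.+1 -> 'rV[R]_d) (y : 'rV[R]_n) :
  param Q y = \sum_i bary_coord y i *: Q i.
Proof.
rewrite param_comb ?sum_bary_coord//; congr param.
by apply/rowP => j; rewrite mxE bary_coordS.
Qed.

Lemma simplex_param (R : realType) n d (Q : 'I_n.+1 -> 'rV[R]_d) (y : 'rV[R]_n) :
  std_simplex y -> simplex Q (param Q y).
Proof.
move=> [y0 y1]; exists (bary_coord y); split.
- move=> i; have [j ->|->] := unliftP ord0 i; first by rewrite bary_coordS.
  by rewrite bary_coord0 subr_ge0.
- by move=> i; rewrite inE.
- exact: sum_bary_coord.
- exact: paramE.
Qed.

Lemma simplexP (R : realType) n d (Q : 'I_n.+1 -> 'rV[R]_d) x :
  simplex Q x -> exists2 y, std_simplex y & x = param Q y.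
Proof.
move=> [a [a0 _ a1 ->]]; rewrite param_comb//.
exists (\row_j a (lift ord0 j)) => //; split => [i|]; first by rewrite mxE.
rewrite -a1 big_ord_recl -[leLHS]add0r lerD//.
by under eq_bigr do rewrite mxE.
Qed.

Lemma param_inj (R : realType) n (P : 'I_n.+1 -> 'rV[R]_n) :
  edge_mx P \in unitmx -> injective (param P).
Proof.
move=> uP x y /addrI/(congr1 (mulmx^~ (invmx (edge_mx P)))).
by rewrite !mulmxK.
Qed.

Lemma simplex_paramE (R : realType) n (P : 'I_n.+1 -> 'rV[R]_n) y :
  edge_mx P \in unitmx -> simplex P (param P y) <-> std_simplex y.
Proof.
move=> uP; split=> [/simplexP[z sz /(param_inj uP) ->]//|]; exact: simplex_param.
Qed.

Lemma simplex_rmeasurable (R : realType) n (P : 'I_n.+1 -> 'rV[R]_n) :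
  edge_mx P \in unitmx -> rmeasurable (simplex P).
Proof.
move=> uP.
have -> : simplex P = [set x | @std_simplex R n
    (x *m invmx (edge_mx P) + (- P ord0 *m invmx (edge_mx P)))].
  apply/seteqP; split => x /=; rewrite -mulmxDl.
    move=> /simplexP[y sy ->].
    by rewrite /param addrC addKr mulmxK.
  move=> /(simplex_param P); rewrite /param -mulmxA mulVmx// mulmx1.
  by rewrite addrC subrK.
by apply: rmeasurable_preimage_affine; exact: std_simplex_rmeasurable.
Qed.

Lemma vol_int_simplex (R : realType) n (P : 'I_n.+1 -> 'rV[R]_n) (f : 'rV[R]_n -> R) :
  edge_mx P \in unitmx -> continuous f ->
  vol_int (simplex P) f = `|\det (edge_mx P)| * std_int (f \o param P).
Proof.
move=> uP cf.
rewrite (vol_int_affine (P ord0) (simplex_rmeasurable uP) _ uP); last first.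
  exact: continuous_rmeasurable.
have -> : (fun y => f (y *m edge_mx P + P ord0)) = f \o param P.
  by apply/funext => y; rewrite /= /param addrC.
congr (_ * vol_int _ _); apply/seteqP; split => y /=; rewrite addrC.
  by move=> /(simplex_paramE y uP).
by move=> /(simplex_paramE y uP).
Qed.

Definition std_vtx (R : realType) n (i : 'I_n.+1) : 'rV[R]_n :=
  if unlift ord0 i is Some j then delta_mx 0 j else 0.

Lemma edge_std_vtx (R : realType) n : edge_mx (@std_vtx R n) = 1%:M.
Proof.
apply/row_matrixP => i; rewrite rowK /std_vtx liftK unlift_none subr0.
by rewrite rowE mulmx1.
Qed.

Lemma param_std_vtx (R : realType) n (y : 'rV[R]_n) : param (@std_vtx R n) y = y.
Proof. by rewrite /param edge_std_vtx mulmx1 /std_vtx unlift_none add0r. Qed.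

Lemma std_simplexE (R : realType) n : @std_simplex R n = simplex (@std_vtx R n).
Proof.
have u1 : edge_mx (@std_vtx R n) \in unitmx by rewrite edge_std_vtx unitmx1.
apply/seteqP; split => y.
  by move=> /(simplex_paramE y u1); rewrite param_std_vtx.
by rewrite -{1}[y]param_std_vtx => /(simplex_paramE y u1).
Qed.

Lemma simplex_perm (R : realType) n d (Q : 'I_n.+1 -> 'rV[R]_d) (s : 'S_n.+1) :
  simplex (Q \o s) = simplex Q.
Proof.
suff h (P : 'I_n.+1 -> 'rV[R]_d) (t : 'S_n.+1) : simplex (P \o t) `<=` simplex P.
  apply/seteqP; split; first exact: h.
  have := h (Q \o s) (s^-1)%g; congr (simplex _ `<=` _).
  by apply/funext => i /=; rewrite permKV.
move=> x [a [a0 _ a1 ->]]; exists (a \o (t^-1)%g); split=> //.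
- by move=> i; exact: a0.
- by move=> i; rewrite inE.
- rewrite -a1 (reindex_inj (@perm_inj _ t))/=.
  by apply: eq_bigr => i _; rewrite permK.
- rewrite [RHS](reindex_inj (@perm_inj _ t))/=.
  by apply: eq_bigr => i _; rewrite permK.
Qed.

(** The edge matrix has the same determinant as the matrix of homogeneous
    coordinates of the vertices, whose rows are permuted with the vertices. *)
Lemma normr_det_edge_perm (R : realType) n (P : 'I_n.+1 -> 'rV[R]_n) (s : 'S_n.+1) :
  `|\det (edge_mx (P \o s))| = `|\det (edge_mx P)|.
Proof.
pose hc (Q : 'I_n.+1 -> 'rV[R]_n) : 'M[R]_(1 + n) :=
  \matrix_i row_mx (1%:M : 'M[R]_1) (Q i).
have det_hc Q : \det (hc Q) = \det (edge_mx Q).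
  have -> : hc Q = block_mx 1%:M 0 (const_mx 1) 1%:M *m
      block_mx 1%:M (Q ord0) 0 (edge_mx Q).
    rewrite mulmx_block !mul1mx !mulmx0 !mul0mx mulmx1 !addr0.
    apply/row_matrixP => i; rewrite rowK.
    have [j ->|j ->] := split_ordP i.
      rewrite block_mxEv rowKu row_row_mx ord1 !row_id.
      by congr (row_mx _ (Q _)); exact/val_inj.
    rewrite block_mxEv rowKd row_row_mx; congr row_mx.
      by apply/rowP => k; rewrite ord1 !mxE.
    have -> : row j (const_mx 1 *m Q ord0 + edge_mx Q) = Q (lift ord0 j).
      apply/rowP => k; rewrite !mxE big_ord1 !mxE mul1r addrC subrK//.
    by congr Q; exact/val_inj.
  by rewrite det_mulmx det_lblock det_ublock !det1 !mul1r.
rewrite -!det_hc (_ : hc (P \o s) = row_perm s (hc P)); last first.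
  by apply/matrixP => i j; rewrite !mxE.
by rewrite row_permE det_mulmx det_perm normrM normrX normrN1 expr1n mul1r.
Qed.

Lemma continuous_rV (R : realType) (T : topologicalType) n (f : T -> 'rV[R]_n) :
  (forall j, continuous (fun x => f x 0 j)) -> continuous f.
Proof.
move=> cf x; apply/cvg_ballP => e e0.
have : \forall y \near x, forall j, ball (f x 0 j) e (f y 0 j).
  by apply: filter_forall => j; move: (cf j x) => /cvg_ballP; exact.
apply: filterS => y h; split => // i j; rewrite ord1; exact: h.
Qed.

Lemma continuousM_fun (R : realType) (T : topologicalType) (f g : T -> R) :
  continuous f -> continuous g -> continuous (fun x => f x * g x).
Proof. by move=> cf cg x; apply: cvgM; [exact: cf|exact: cg]. Qed.

Lemma continuousD_fun (R : realType) (T : topologicalType) (f g : T -> R) :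
  continuous f -> continuous g -> continuous (fun x => f x + g x).
Proof. by move=> cf cg x; apply: cvgD; [exact: cf|exact: cg]. Qed.

Lemma continuousB_fun (R : realType) (T : topologicalType) (f g : T -> R) :
  continuous f -> continuous g -> continuous (fun x => f x - g x).
Proof. by move=> cf cg x; apply: cvgB; [exact: cf|exact: cg]. Qed.

Lemma continuous_cst (R : realType) (T : topologicalType) (a : R) :
  continuous (fun _ : T => a).
Proof. by move=> x; exact: cvg_cst. Qed.

Lemma continuous_affine (R : realType) n d (A : 'M[R]_(n, d)) b :
  continuous (fun y : 'rV[R]_n => y *m A + b : 'rV[R]_d).
Proof.
apply: continuous_rV => j.
have -> : (fun y : 'rV[R]_n => (y *m A + b) 0 j) =
    (fun y => \sum_k y 0 k * A k j + b 0 j) by apply/funext => y; rewrite !mxE.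
apply: continuousD_fun; last exact: continuous_cst.
apply: continuous_sum => k; apply: continuousM_fun; last exact: continuous_cst.
exact: coord_continuous.
Qed.

Lemma continuous_param (R : realType) n d (Q : 'I_n.+1 -> 'rV[R]_d) :
  continuous (param Q).
Proof.
have -> : param Q = fun y => y *m edge_mx Q + Q ord0.
  by apply/funext => y; rewrite /param addrC.
exact: continuous_affine.
Qed.

Lemma continuous_comp_param (R : realType) n d (Q : 'I_n.+1 -> 'rV[R]_d)
    (f : 'rV[R]_d -> R) : continuous f -> continuous (f \o param Q).
Proof.
move=> cf y; apply: continuous_comp; first exact: continuous_param.
exact: cf.
Qed.

(** The parameter simplex itself is mapped onto itself, with unit Jacobian, by
    the affine map that permutes its vertices. *)
Lemma std_int_perm (R : realType) n d (Q : 'I_n.+1 -> 'rV[R]_d) (s : 'S_n.+1)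
    (f : 'rV[R]_d -> R) : continuous f ->
  std_int (f \o param (Q \o s)) = std_int (f \o param Q).
Proof.
move=> cf.
have ds : `|\det (edge_mx (@std_vtx R n \o s))| = 1.
  by rewrite normr_det_edge_perm edge_std_vtx det1 normr1.
have us : edge_mx (@std_vtx R n \o s) \in unitmx.
  by rewrite unitmxE unitfE -normr_eq0 ds oner_eq0.
rewrite [RHS]/std_int std_simplexE -(simplex_perm _ s).
rewrite vol_int_simplex//; last exact: continuous_comp_param.
rewrite ds mul1r; congr std_int; apply/funext => y /=; congr f.
rewrite (paramE (Q \o s)) (paramE (@std_vtx R n \o s)).
have -> : param Q (\sum_i bary_coord y i *: (@std_vtx R n \o s) i) =
    \sum_i bary_coord y i *: param Q (@std_vtx R n (s i)) :> 'rV[R]_d.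
  rewrite /param; under [RHS]eq_bigr do rewrite scalerDr.
  rewrite big_split/= -scaler_suml sum_bary_coord scale1r; congr (_ + _).
  by rewrite mulmx_suml; apply: eq_bigr => i _; rewrite scalemxAl.
apply: eq_bigr => i _; congr (_ *: _); rewrite /=.
rewrite /param /std_vtx; have [j ->|->] := unliftP ord0 (s i).
  by rewrite -rowE rowK addrC subrK.
by rewrite mul0mx addr0.
Qed.

(** * Integration of a partial derivative over the standard simplex *)

Lemma tuple_prod_integrable (R : realType) n (f : 'rV[R]_(1 + n) -> \bar R) :
  rmeasurable_fun f ->
  (lebesgue_tuple R n.+1).-integrable setT (f \o @row_of_tuple R n.+1) ->
  (@lebesgue_measure R \x lebesgue_tuple R n)%E.-integrable setT
    (fun p : measurableTypeR R * n.-tuple (measurableTypeR R) =>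
      f (row_mx (p.1 : R)%:M (row_of_tuple p.2))).
Proof.
move=> mf /integrableP[_ foo]; apply/integrableP.
split; first exact: measurable_tuple_pair.
have maf : rmeasurable_fun (fun x => `|f x|)%E.
  by apply: measurableT_comp.
rewrite (fubini_tonelli1 _ (measurable_tuple_pair maf)) //.
by rewrite /fubini_F/= -(lebesgue_tuple_tonelli maf).
Qed.

Lemma tuple_fubini (R : realType) n (f : 'rV[R]_(1 + n) -> \bar R) :
  rmeasurable_fun f ->
  (lebesgue_tuple R n.+1).-integrable setT (f \o @row_of_tuple R n.+1) ->
  (\int[lebesgue_tuple R n.+1]_y f (row_of_tuple y) =
   \int[lebesgue_tuple R n]_y \int[lebesgue_measure]_x
    f (row_mx (x : R)%:M (row_of_tuple y)))%E.
Proof.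
move=> mf intf.
have mc := @measurable_tuple_cons _ (measurableTypeR R) n.
pose m : {measure set (n.+1.-tuple (measurableTypeR R)) -> \bar R} :=
  measure_function_pushforward__canonical__measure_function_Measure
    (@lebesgue_measure R \x lebesgue_tuple R n)%E mc.
have ip := tuple_prod_integrable mf intf.
have fE : (f \o @row_of_tuple R n.+1) \o @tuple_cons (measurableTypeR R) n =
  (fun p => f (row_mx (p.1 : R)%:M (row_of_tuple p.2))).
  by apply/funext => -[x y] /=; rewrite row_of_tuple_cons.
rewrite (eq_measure_integral m); last by [].
rewrite (integral_pushforward mc (f := f \o @row_of_tuple R n.+1) mf _ measurableT).
  by rewrite fE preimage_setT -(integral21_prod_meas1 ip).
by rewrite fE preimage_setT.
Qed.

Lemma row_mx_ord0 (R : realType) n (x : R) (y : 'rV[R]_n) :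
  (row_mx x%:M y : 'rV[R]_(1 + n)) 0 ord0 = x.
Proof. by rewrite mxE; case: splitP => // j _; rewrite ord1 mxE eqxx mulr1n. Qed.

Lemma row_mx_lift (R : realType) n (x : R) (y : 'rV[R]_n) j :
  (row_mx x%:M y : 'rV[R]_(1 + n)) 0 (lift ord0 j) = y 0 j.
Proof.
rewrite mxE; case: splitP => k /=; rewrite /bump leq0n; first by rewrite ord1.
by move=> [jk]; congr (y 0 _); exact/val_inj.
Qed.

Lemma std_simplex_row_mx (R : realType) n (x : R) (y : 'rV[R]_n) :
  @std_simplex R n.+1 (row_mx x%:M y : 'rV[R]_(1 + n)) <->
  std_simplex y /\ `[0, 1 - \sum_j y 0 j]%classic x.
Proof.
pose e0 := row_mx_ord0 x y; pose eS := row_mx_lift x y.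
rewrite /std_simplex/= big_ord_recl e0 in_itv/=.
under eq_bigr do rewrite eS.
split=> [[h0 h1]|[[h0 h1] /andP[x0 x1]]].
  have x0 : 0 <= x by rewrite -e0; exact: h0.
  split; last by rewrite x0/= lerBrDr.
  split; first by move=> j; rewrite -eS; exact: h0.
  by apply: le_trans h1; rewrite lerDr.
split; last by rewrite -lerBrDr.
by move=> i; have [j ->|->] := unliftP ord0 i; rewrite ?eS ?e0.
Qed.

Lemma continuous_row_mx (R : realType) n (T : topologicalType) (f : T -> R)
    (g : T -> 'rV[R]_n) : continuous f -> continuous g ->
  continuous (fun x => row_mx (f x)%:M (g x) : 'rV[R]_(1 + n)).
Proof.
move=> cf cg; apply: continuous_rV => i; have [j ->|j ->] := split_ordP i.
  by under eq_fun do rewrite row_mxEl ord1 mxE eqxx mulr1n.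
under eq_fun do rewrite row_mxEr.
move=> x; apply: (continuous_comp (f := g) (g := fun z => z 0 j)).
  exact: cg.
exact: coord_continuous.
Qed.

(** Fubini, with the fundamental theorem of calculus on each segment
    [[0, 1 - \sum_j y 0 j]] of the first variable. *)
Lemma std_int_deriv (R : realType) n (g h : 'rV[R]_(1 + n) -> R) :
  continuous g -> continuous h ->
  (forall (t : R) y, is_derive t 1 (fun t : R => g (row_mx t%:M y))
    (h (row_mx t%:M y))) ->
  @std_int R n.+1 h =
  std_int (fun y : 'rV[R]_n => g (row_mx (1 - \sum_j y 0 j)%:M y)) -
  std_int (fun y : 'rV[R]_n => g (row_mx (0 : R)%:M y)).
Proof.
move=> cg ch dg.
pose S := @std_simplex R n.+1; have mS : rmeasurable S by exact: std_simplex_rmeasurable.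
have mG := rmeasurable_patch mS (continuous_rmeasurable ch).
have cs : continuous (fun y : 'rV[R]_n => 1 - \sum_j y 0 j).
  apply: continuousB_fun; first exact: continuous_cst.
  by apply: continuous_sum => j; exact: coord_continuous.
have cg1 : continuous (fun y : 'rV[R]_n => g (row_mx (1 - \sum_j y 0 j)%:M y)).
  move=> y; apply: (continuous_comp (f := fun y : 'rV[R]_n => row_mx (1 - \sum_j y 0 j)%:M y)).
    by apply: continuous_row_mx => // z; exact: cvg_id.
  exact: cg.
have cg0 : continuous (fun y : 'rV[R]_n => g (row_mx (0 : R)%:M y)).
  move=> y; apply: (continuous_comp (f := fun y : 'rV[R]_n => row_mx (0 : R)%:M y)).
    by apply: continuous_row_mx => z; [exact: continuous_cst|exact: cvg_id].
  exact: cg.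
rewrite -std_intB// /std_int vol_int_patch [RHS]vol_int_patch; congr fine.
rewrite (tuple_fubini mG); last first.
  have -> : ((EFin \o h) \_ S) \o @row_of_tuple R n.+1 =
      (EFin \o (h \o @row_of_tuple R n.+1)) \_ (@row_of_tuple R n.+1 @^-1` S).
    by apply/funext => y /=; rewrite !patchE.
  by apply/(integrable_mkcond _ mS); exact: continuous_std_integrable.
apply: eq_integral => y' _; move: (row_of_tuple y') => y.
rewrite [RHS]patchE; case: ifPn => [|nSy]; last first.
  rewrite (eq_integral (cst 0%E)) ?integral0// => x _.
  rewrite patchE ifF//; apply/negbTE; apply: contra nSy.
  by rewrite !inE => /std_simplex_row_mx[].
rewrite inE => Sy /=; set s := 1 - _.
have s0 : 0 <= s by rewrite subr_ge0; exact: Sy.2.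
transitivity (\int[@lebesgue_measure R]_(x in `[0%R, s]) (h (row_mx (x : R)%:M y))%:E)%E.
  rewrite [RHS]integral_mkcond; apply: eq_integral => x _.
  rewrite !patchE; congr (if _ then _ else _).
  by apply/idP/idP; rewrite !inE => H; [case/std_simplex_row_mx: H|apply/std_simplex_row_mx].
have ctx (f : 'rV[R]_(1 + n) -> R) : continuous f -> continuous (fun x : R => f (row_mx x%:M y)).
  move=> cf x; apply: (continuous_comp (f := fun x : R => row_mx x%:M y)); last exact: cf.
  by apply: continuous_row_mx => z; [exact: cvg_id|exact: cst_continuous].
(* the fundamental theorem of calculus needs a nondegenerate segment *)
have [s_eq0|sn0] := eqVneq s 0.
  by rewrite s_eq0 set_itv1 integral_set1 subrr.
have {s0 sn0} s0 : 0 < s by rewrite lt_neqAle eq_sym sn0.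
rewrite (@continuous_FTC2 R _ (fun x : R => g (row_mx x%:M y)))//.
- by apply: continuous_subspaceT; exact: ctx.
- split.
  + by move=> x _; exact: (@ex_derive _ _ _ _ _ _ _ (dg x y)).
  + apply: cvg_at_right_filter; exact: ctx.
  + apply: cvg_at_left_filter; exact: ctx.
- by move=> x _; rewrite derive1E; exact: (@derive_val _ _ _ _ _ _ _ (dg x y)).
Qed.

Lemma std_int_fin (R : realType) n (f : 'rV[R]_n -> R) : continuous f ->
  (std_int f)%:E = (\int[lebesgue_tuple R n]_y
    ((EFin \o f) \_ (@std_simplex R n)) (row_of_tuple y))%E.
Proof.
move=> cf; rewrite /std_int vol_int_patch fineK//.
rewrite (_ : integral _ _ _ = \int[lebesgue_tuple R n]_(y in
    @row_of_tuple R n @^-1` @std_simplex R n) (f (row_of_tuple y))%:E)%E.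
  apply: integrable_fin_num; first exact: std_simplex_rmeasurable.
  exact: continuous_std_integrable.
rewrite [RHS]integral_mkcond; apply: eq_integral => y _.
by rewrite !patchE.
Qed.

(** Fubini on the product of the interval and the simplex, a bounded set on
    which the continuous function [f] is integrable. *)
Lemma std_int_integrable (R : realType) n (f : 'rV[R]_(1 + n) -> R) (a b : R) :
  continuous f ->
  (@lebesgue_measure R).-integrable `[a, b]
    (fun t : R => (std_int (fun y : 'rV[R]_n => f (row_mx t%:M y)))%:E).
Proof.
move=> cf.
pose D : set 'rV[R]_(1 + n) :=
  [set v | `[a, b]%classic (lsubmx v 0 0) /\ std_simplex (rsubmx v)].
have mD : @rmeasurable R n.+1 D.
  pose A : 'M[R]_(1 + n, n) := col_mx 0 1%:M.
  have DE : @row_of_tuple R n.+1 @^-1` D =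
      ((fun y => (row_of_tuple y : 'rV[R]_(1 + n)) 0 (lshift n ord0)) @^-1` `[a, b]) `&`
      (@row_of_tuple R n.+1 @^-1` [set x | @std_simplex R n (x *m A + 0)]).
    have rs (y : 'rV[R]_(1 + n)) : y *m A + 0 = rsubmx y.
      by rewrite addr0 -[X in X *m _](@hsubmxK _ 1 1 n) mul_row_col mulmx0 add0r mulmx1.
    have ls (y : 'rV[R]_(1 + n)) : lsubmx y 0 0 = y 0 (lshift n ord0) by rewrite mxE.
    by apply/seteqP; split=> y; rewrite /D/= ls rs.
  rewrite /rmeasurable DE; apply: measurableI.
    rewrite -[X in measurable X]setTI.
    exact: (@rmeasurable_coord R n.+1 (lshift n (ord0 : 'I_1)) measurableT _
      (measurable_itv `[a, b])).
  exact: (@rmeasurable_preimage_affine R n.+1 n _ A 0 (@std_simplex_rmeasurable R n)).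
have Dc : D `<=` @cube R n.+1 (Num.min a 0) (Num.max b 1).
  move=> v [/=]; rewrite in_itv/= => /andP[va vb] /std_simplex_cube vS i.
  rewrite /= in_itv/= ge_min le_max.
  have [j ij|j ij] := split_ordP (i : 'I_(1 + n)).
    by move: va vb; rewrite mxE -[lshift _ 0](_ : i = _) ?ij ?ord1// => -> ->.
  have := vS j; rewrite /= in_itv/= mxE -ij => /andP[-> ->].
  by rewrite !orbT.
have intf : (lebesgue_tuple R n.+1).-integrable setT
    (((EFin \o f) \_ D) \o @row_of_tuple R n.+1).
  have -> : ((EFin \o f) \_ D) \o @row_of_tuple R n.+1 =
      (EFin \o (f \o @row_of_tuple R n.+1)) \_ (@row_of_tuple R n.+1 @^-1` D).
    by apply/funext => y /=; rewrite !patchE.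
  by apply/(integrable_mkcond _ mD); exact: continuous_integrable Dc cf.
have i1 := integrable_fubini_F (tuple_prod_integrable (rmeasurable_patch mD (continuous_rmeasurable cf)) intf).
have := @integrableS _ _ _ _ setT (`[a, b]%classic : set (measurableTypeR R)) _
  measurableT (measurable_itv `[a, b]) (@subsetT _ _) i1.
apply: eq_integrable => // t; rewrite inE => tab.
rewrite std_int_fin; last first.
  move=> y; apply: (continuous_comp (f := fun y : 'rV[R]_n => row_mx t%:M y)).
    by apply: continuous_row_mx => z; [exact: cst_continuous|exact: cvg_id].
  exact: cf.
rewrite /fubini_F; apply: eq_integral => y _; rewrite !patchE /=.
congr (if _ then _ else _); apply/idP/idP; rewrite !inE /D/= row_mxKr; first by case.
by move=> ?; split => //; rewrite row_mxKl mxE eqxx mulr1n.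
Qed.

(** * The divergence theorem on a simplex *)

Definition C1 (R : realType) n (f : 'rV[R]_n -> R) : Prop :=
  (forall x, differentiable f x) /\
  (forall v, continuous (fun x => 'D_v f x)).

Lemma C1_continuous (R : realType) n (f : 'rV[R]_n -> R) : C1 f -> continuous f.
Proof. by move=> [df _] x; exact: differentiable_continuous. Qed.

(** The difference quotients of both sides are the same function. *)
Lemma derive_affine (R : realType) (W : normedModType R) n d (f : 'rV[R]_d -> W)
    (A : 'M[R]_(n, d)) (b : 'rV[R]_d) (v x : 'rV[R]_n) :
  'D_v (fun x => f (x *m A + b)) x = 'D_(v *m A) f (x *m A + b).
Proof.
rewrite /derive; apply: (congr1 (fun F : R -> W => lim (F @ 0^'))).
by apply/funext => h; rewrite /= mulmxDl -scalemxAl addrA.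
Qed.

Lemma derive_dir (R : realType) n (f : 'rV[R]_n -> R) v x :
  differentiable f x -> 'D_v f x = \sum_i v 0 i * 'D_(delta_mx 0 i) f x.
Proof.
move=> df; rewrite deriveE// {1}(row_sum_delta v) linear_sum/=.
by apply: eq_bigr => i _; rewrite linearZ deriveE.
Qed.

Lemma is_derive_line (R : realType) d (f : 'rV[R]_d -> R) (v c : 'rV[R]_d) (t : R) :
  differentiable f (t *: v + c) ->
  is_derive t 1 (fun t : R => f (t *: v + c)) ('D_v f (t *: v + c)).
Proof.
move=> df.
have qE : (fun h : R => h^-1 *: ((fun t : R => f (t *: v + c)) (h *: 1 + t) -
      f (t *: v + c))) =
    (fun h : R => h^-1 *: (f (h *: v + (t *: v + c)) - f (t *: v + c))).
  by apply/funext => h; rewrite addrA -scalerDl [_ *: 1]mulr1.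
apply: DeriveDef.
  by have := @diff_derivable _ _ _ _ _ v df; rewrite /derivable/= -qE.
by rewrite /derive; apply: (congr1 (fun F : R -> R => lim (F @ 0^'))); exact: qE.
Qed.

Lemma param_row_mx (R : realType) n d (Q : 'I_n.+2 -> 'rV[R]_d) (t : R) (y : 'rV[R]_n) :
  param Q (row_mx t%:M y : 'rV[R]_(1 + n)) =
  t *: (Q (lift ord0 ord0) - Q ord0) +
  (Q ord0 + \sum_j y 0 j *: (Q (lift ord0 (lift ord0 j)) - Q ord0)).
Proof.
rewrite /param mulmx_sum_row big_ord_recl row_mx_ord0 rowK addrCA.
congr (_ + (_ + _)); apply: eq_bigr => j _.
by rewrite row_mx_lift rowK.
Qed.

(** The integral over the face opposite to [P i], with respect to its parameters:
    the factor [face_area] below is left out. *)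
Definition face_int (R : realType) n (P : 'I_n.+2 -> 'rV[R]_n.+1) (i : 'I_n.+2)
    (f : 'rV[R]_n.+1 -> R) : R := std_int (f \o param (P \o lift i)).

(** In the parametrization whose vertices are listed as [P ord0], [P i] and the
    others, this is the integration of a partial derivative over the standard
    simplex; the two faces that remain are those opposite to [P ord0] and to
    [P i]. *)
Lemma vol_int_derive_edge (R : realType) n (P : 'I_n.+2 -> 'rV[R]_n.+1)
    (i : 'I_n.+1) (g : 'rV[R]_n.+1 -> R) :
  edge_mx P \in unitmx -> C1 g ->
  vol_int (simplex P) (fun x => 'D_(P (lift ord0 i) - P ord0) g x) =
  `|\det (edge_mx P)| * (face_int P ord0 g - face_int P (lift ord0 i) g).
Proof.
move=> uP [dg cdg]; have cg := C1_continuous (conj dg cdg).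
pose t : 'S_n.+1 := lift_perm ord0 i 1.
pose s : 'S_n.+2 := lift_perm ord0 ord0 t.
pose P' := P \o s.
have P0 : P' ord0 = P ord0 by rewrite /P'/= lift_perm_id.
have P1 : P' (lift ord0 ord0) = P (lift ord0 i).
  by rewrite /P'/= lift_perm_lift lift_perm_id.
have PS r : P' (lift ord0 (lift ord0 r)) = P (lift ord0 (lift i r)).
  by rewrite /P'/= !lift_perm_lift perm1.
have uP' : edge_mx P' \in unitmx.
  by rewrite unitmxE unitfE -normr_eq0 normr_det_edge_perm normr_eq0 -unitfE -unitmxE.
rewrite -(simplex_perm P s) vol_int_simplex// normr_det_edge_perm.
congr (_ * _); set v := P (lift ord0 i) - P ord0.
have dgP (x : R) (y : 'rV[R]_n) : is_derive x 1 (fun x : R => (g \o param P') (row_mx x%:M y))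
    (((fun x => 'D_v g x) \o param P') (row_mx x%:M y)).
  rewrite /=; under eq_fun do rewrite param_row_mx P1 P0.
  by rewrite param_row_mx P1 P0; exact: is_derive_line.
have cgP : continuous (g \o param P') by exact: continuous_comp_param.
have cdgP : continuous ((fun x => 'D_v g x) \o param P').
  by apply: (@continuous_comp_param _ _ _ _ (fun x => 'D_v g x)); exact: cdg.
rewrite (std_int_deriv cgP cdgP dgP).
congr (_ - _).
  (* this face gets its vertices in another order *)
  rewrite /face_int -(std_int_perm (P \o lift ord0) t)//.
  congr std_int; apply/funext => y /=; congr g.
  rewrite param_row_mx /param mulmx_sum_row.
  have T0 : ((P \o lift ord0) \o t) ord0 = P' (lift ord0 ord0).
    by rewrite P1 /= lift_perm_id.
  have TS r : ((P \o lift ord0) \o t) (lift ord0 r) = P' (lift ord0 (lift ord0 r)).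
    by rewrite PS /= lift_perm_lift perm1.
  rewrite T0 scalerBl scale1r scaler_suml addrACA subrK; congr (_ + _).
  rewrite addrC -sumrB; apply: eq_bigr => r _.
  by rewrite rowK TS T0 -scalerBr opprB addrA subrK.
congr std_int; apply/funext => y /=; congr g.
rewrite param_row_mx scale0r add0r /param mulmx_sum_row /=.
have L0 : lift (lift ord0 i) ord0 = ord0 :> 'I_n.+2 by exact/val_inj.
have LS r : lift (lift ord0 i) (lift ord0 r) = lift ord0 (lift i r) :> 'I_n.+2.
  apply/val_inj; rewrite /= /bump !leq0n !add1n ltnS; case: leqP; rewrite ?add1n ?add0n//.
rewrite L0 P0; congr (_ + _); apply: eq_bigr => r _.
by rewrite rowK/= LS L0 PS.
Qed.

Lemma dotvE (R : realType) d (u v : 'rV[R]_d) : dotv u v = (u *m v^T) 0 0.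
Proof. by rewrite mxE; apply: eq_bigr => i _; rewrite mxE. Qed.

Lemma dotvB (R : realType) d (u w v : 'rV[R]_d) : dotv (u - w) v = dotv u v - dotv w v.
Proof. by rewrite !dotvE mulmxBl !mxE. Qed.

Lemma mulmx_dotv (R : realType) m d (A : 'M[R]_(m, d)) (v : 'rV[R]_d) j :
  (A *m v^T) j 0 = dotv (row j A) v.
Proof. by rewrite !mxE; apply: eq_bigr => k _; rewrite !mxE. Qed.

(** The Gram factor of [surf_intv], that is [n`!] times the area of the face
    opposite to [P i]. *)
Definition face_area (R : realType) n (P : 'I_n.+2 -> 'rV[R]_n.+1) (i : 'I_n.+2) : R :=
  Num.sqrt (\det (edge_mx (P \o lift i) *m (edge_mx (P \o lift i))^T)).

(** The distance from [P i] to the opposite face, when [nu] is the outward unit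
    normal of that face. *)
Definition height (R : realType) n (P : 'I_n.+2 -> 'rV[R]_n.+1) (i : 'I_n.+2)
  (nu : 'rV[R]_n.+1) : R := dotv (P (lift i ord0) - P i) nu.

Lemma height_gt0 (R : realType) n (P : 'I_n.+2 -> 'rV[R]_n.+1) i nu :
  is_outward_unit_normal P i nu -> 0 < height P i nu.
Proof.
move=> [_ _ h]; have := h (lift i ord0); rewrite eq_sym neq_lift => /(_ isT).
by rewrite /height !dotvB subr_lt0 subr_gt0.
Qed.

(** With [Q] the edges of the face and [v] an edge from the opposite vertex, the
    matrices of rows [nu, Q] and [v, Q] differ by a triangular factor whose
    corner entry is the inverse of the height. The square of the first
    determinant is the Gram determinant, and the second is the determinant of the
    edge matrix of [P] with its vertices permuted. *)
Lemma face_area_height (R : realType) n (P : 'I_n.+2 -> 'rV[R]_n.+1) i nu :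
  edge_mx P \in unitmx -> is_outward_unit_normal P i nu ->
  face_area P i * height P i nu = `|\det (edge_mx P)|.
Proof.
move=> uP onu; have h0 := height_gt0 onu; case: onu => nu1 nuf _.
set h := height P i nu in h0 *.
pose Q := edge_mx (P \o lift i); pose v := P (lift i ord0) - P i.
pose B : 'M[R]_(1 + n) := col_mx nu Q; pose C : 'M[R]_(1 + n) := col_mx v Q.
have detC : `|\det C| = `|\det (edge_mx P)|.
  rewrite -(normr_det_edge_perm P (lift_perm ord0 i 1)).
  have -> : edge_mx (P \o lift_perm ord0 i 1) =
      (block_mx 1%:M 0 (const_mx 1) 1%:M : 'M[R]_(1 + n)) *m C.
    rewrite mul_block_col mul1mx mul0mx addr0 mul1mx.
    apply/row_matrixP => j; rewrite rowK /= lift_perm_id lift_perm_lift perm1.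
    have [k ->|k ->] := split_ordP (j : 'I_(1 + n)).
      rewrite [RHS](@rowKu _ 1 n) ord1 row_id /v; congr (P (lift i _) - _); exact/val_inj.
    rewrite [RHS](@rowKd _ 1 n) linearD /= rowK /=.
    have -> : row k (const_mx 1 *m v) = v.
      by apply/rowP => l; rewrite !mxE big_ord1 !mxE mul1r.
    rewrite /v (_ : rshift 1 k = lift ord0 k); last exact/val_inj.
    by rewrite [RHS]addrC addrA subrK.
  by rewrite det_mulmx (@det_lblock R 1 n) !det1 !mul1r.
have uC : C \in unitmx.
  by rewrite unitmxE unitfE -normr_eq0 detC normr_eq0 -unitfE -unitmxE.
have Qnu : Q *m nu^T = 0.
  by apply/colP => j; rewrite mulmx_dotv rowK mxE /=; apply: nuf; rewrite eq_sym neq_lift.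
pose w : 'rV[R]_(1 + n) := nu *m invmx C.
have nuE : nu = lsubmx w *m v + rsubmx w *m Q.
  by rewrite -mul_row_col hsubmxK /w mulmxKV.
have al : (lsubmx w) 0 0 * h = 1.
  rewrite -nu1 dotvE {1}nuE mulmxDl -[X in _ + X]mulmxA Qnu mulmx0 addr0 -mulmxA.
  by rewrite [RHS]mxE big_ord1; congr (_ * _); rewrite /h /height dotvE.
have detB : \det B = lsubmx w 0 0 * \det C.
  have -> : B = block_mx (lsubmx w) (rsubmx w) 0 1%:M *m C.
    by rewrite mul_block_col -nuE mul0mx add0r mul1mx.
  by rewrite det_mulmx (@det_ublock R 1 n) det1 mulr1 det_mx11.
have detB2 : \det B ^+ 2 = \det (Q *m Q^T).
  rewrite expr2 -{2}det_tr -det_mulmx tr_col_mx mul_col_row.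
  have -> : nu *m Q^T = 0 by apply: trmx_inj; rewrite trmx_mul trmxK Qnu trmx0.
  rewrite Qnu (@det_lblock R 1 n) det_mx11 -dotvE nu1 mul1r //.
rewrite /face_area -/Q -detB2 sqrtr_sqr detB normrM -detC mulrAC.
have al0 : 0 < lsubmx w 0 0 by rewrite -(pmulr_lgt0 _ h0) al.
by rewrite (gtr0_norm al0) al mul1r.
Qed.

(** The columns of the inverse edge matrix are the gradients of the barycentric
    coordinates: each is orthogonal to the face on which its coordinate
    vanishes. *)
Lemma face_normal_lift (R : realType) n (P : 'I_n.+2 -> 'rV[R]_n.+1)
    (i a : 'I_n.+1) nu :
  edge_mx P \in unitmx -> is_outward_unit_normal P (lift ord0 i) nu ->
  face_area P (lift ord0 i) * nu 0 a =
  - (`|\det (edge_mx P)| * invmx (edge_mx P) a i).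
Proof.
move=> uP onu; rewrite -(face_area_height uP onu); case: onu => _ nuf _.
have E : edge_mx P *m nu^T = - height P (lift ord0 i) nu *: delta_mx i 0.
  apply/colP => j; rewrite mulmx_dotv rowK !mxE eqxx andbT; have [->|ji] := eqVneq j i.
    rewrite mulr1 /height (_ : lift (lift ord0 i) ord0 = ord0); last exact/val_inj.
    by rewrite !dotvB opprB.
  rewrite mulr0; apply: nuf; last exact: neq_lift.
  by rewrite (inj_eq lift_inj).
have -> : nu 0 a = - height P (lift ord0 i) nu * invmx (edge_mx P) a i.
  have := congr1 (mulmx (invmx (edge_mx P))) E; rewrite mulKmx// => /colP/(_ a).
  by rewrite mxE => ->; rewrite -scalemxAr -colE !mxE.
by rewrite mulNr mulrN mulrA.
Qed.

(** The barycentric coordinate of [P ord0] is one minus the sum of the others. *)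
Lemma face_normal0 (R : realType) n (P : 'I_n.+2 -> 'rV[R]_n.+1)
    (a : 'I_n.+1) nu :
  edge_mx P \in unitmx -> is_outward_unit_normal P ord0 nu ->
  face_area P ord0 * nu 0 a =
  `|\det (edge_mx P)| * \sum_i invmx (edge_mx P) a i.
Proof.
move=> uP onu; rewrite -(face_area_height uP onu); case: onu => _ nuf _.
have E : edge_mx P *m nu^T = height P ord0 nu *: const_mx 1.
  apply/colP => j; rewrite mulmx_dotv rowK !mxE mulr1 /height; apply/eqP; rewrite -subr_eq0 -dotvB.
  rewrite opprB addrA subrK; apply/eqP; apply: nuf;
  by rewrite eq_sym neq_lift.
have -> : nu 0 a = height P ord0 nu * \sum_i invmx (edge_mx P) a i.
  have := congr1 (mulmx (invmx (edge_mx P))) E; rewrite mulKmx// => /colP/(_ a).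
  rewrite mxE => ->; rewrite -scalemxAr !mxE; congr (_ * _).
  by apply: eq_bigr => j _; rewrite !mxE mulr1.
by rewrite mulrA.
Qed.

Lemma vol_int_simplex_sum (R : realType) n (P : 'I_n.+1 -> 'rV[R]_n) (I : Type)
    (r : seq I) (a : I -> R) (f : I -> 'rV[R]_n -> R) :
  edge_mx P \in unitmx -> (forall i, continuous (f i)) ->
  vol_int (simplex P) (fun x => \sum_(i <- r) a i * f i x) =
  \sum_(i <- r) a i * vol_int (simplex P) (f i).
Proof.
move=> uP cf; rewrite vol_int_simplex//; last first.
  by apply: continuous_sum => i; apply: continuousM_fun => //; exact: continuous_cst.
rewrite (@std_int_sum R n _ r (fun i y => a i * f i (param P y))); last first.
  move=> i; apply: continuousM_fun; first exact: continuous_cst.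
  exact: (@continuous_comp_param _ _ _ P (f i) (cf i)).
rewrite mulr_sumr; apply: eq_bigr => i _.
rewrite (@std_intZ R n (a i) (f i \o param P)); last exact: continuous_comp_param.
by rewrite vol_int_simplex// mulrCA.
Qed.

(** The partial derivatives are combinations of the derivatives along the edges
    from [P ord0], with the entries of the inverse edge matrix as coefficients;
    the same entries give the normals of the faces. *)
Lemma simplex_divergence (R : realType) n (P : 'I_n.+2 -> 'rV[R]_n.+1)
    (nu : 'I_n.+2 -> 'rV[R]_n.+1) (G : 'I_n.+1 -> 'rV[R]_n.+1 -> R) :
  edge_mx P \in unitmx -> (forall i, is_outward_unit_normal P i (nu i)) ->
  (forall a, C1 (G a)) ->
  vol_int (simplex P) (fun x => \sum_a 'D_(delta_mx 0 a) (G a) x) =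
  \sum_i face_area P i * face_int P i (fun x => \sum_a nu i 0 a * G a x).
Proof.
move=> uP hnu cG; set E := edge_mx P.
pose dG (p : 'I_n.+1 * 'I_n.+1) x := 'D_(P (lift ord0 p.2) - P ord0) (G p.1) x.
have -> : (fun x => \sum_a 'D_(delta_mx 0 a) (G a) x) =
    (fun x => \sum_(p : 'I_n.+1 * 'I_n.+1) invmx E p.1 p.2 * dG p x).
  apply/funext => x.
  rewrite -(pair_big xpredT xpredT (fun a i => invmx E a i * dG (a, i) x))/=.
  apply: eq_bigr => a _; have [dGa _] := cG a.
  rewrite deriveE// -[X in 'd _ _ X](mulmxKV uP) mulmx_sum_row linear_sum/=.
  apply: eq_bigr => i _; rewrite linearZ/= rowK -rowE mxE.
  by congr (_ * _); rewrite /dG/= deriveE.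
rewrite vol_int_simplex_sum//; last by move=> p; have [_] := cG p.1; exact.
rewrite -(pair_big xpredT xpredT (fun a i => invmx E a i * vol_int (simplex P) (dG (a, i))))/=.
have cGa a : continuous (G a) := C1_continuous (cG a).
have faceE i : face_int P i (fun x => \sum_a nu i 0 a * G a x) =
    \sum_a nu i 0 a * face_int P i (G a).
  rewrite /face_int (@std_int_sum R n _ _ (fun a y => nu i 0 a * G a (param (P \o lift i) y))).
    apply: eq_bigr => a _.
    rewrite (@std_intZ R n (nu i 0 a) (G a \o param (P \o lift i)))//.
    exact: continuous_comp_param.
  move=> a; apply: continuousM_fun; first exact: continuous_cst.
  exact: (@continuous_comp_param _ _ _ (P \o lift i) (G a) (cGa a)).
under [RHS]eq_bigr do rewrite faceE mulr_sumr.
rewrite [RHS]exchange_big/=; apply: eq_bigr => a _.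
rewrite [RHS]big_ord_recl mulrA face_normal0//.
under [X in _ = _ + X]eq_bigr do rewrite mulrA face_normal_lift// mulNr.
rewrite sumrN mulr_sumr mulr_suml -sumrB.
apply: eq_bigr => i _; rewrite /dG/= vol_int_derive_edge// -/E.
by rewrite -mulrBr mulrCA mulrA.
Qed.

(** * Continuously differentiable functions *)

Lemma C1_cst (R : realType) n (a : R) : C1 (fun _ : 'rV[R]_n => a).
Proof.
split=> [x|v]; first exact: differentiable_cst.
by under eq_fun do rewrite derive_cst; exact: continuous_cst.
Qed.

Lemma derive_coord (R : realType) n (i : 'I_n) (v x : 'rV[R]_n) :
  'D_v (fun x : 'rV[R]_n => x 0 i) x = v 0 i.
Proof.
have dx : derivable (@id 'rV[R]_n) x v by exact: derivable_id.
by have := congr1 (fun M : 'rV_n => M 0 i) (derive_mx dx); rewrite mxE derive_id => ->.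
Qed.

Lemma C1_coord (R : realType) n (i : 'I_n) : C1 (fun x : 'rV[R]_n => x 0 i).
Proof.
split=> [x|v]; first exact: differentiable_coord.
by under eq_fun do rewrite derive_coord; exact: continuous_cst.
Qed.

Section C1_closure.
Variables (R : realType) (n : nat).
Implicit Types f g : 'rV[R]_n -> R.

Lemma C1_derivable f x v : C1 f -> derivable f x v.
Proof. by move=> [df _]; exact: diff_derivable. Qed.

Lemma C1_deriveD f g x v : C1 f -> C1 g ->
  'D_v (fun x => f x + g x) x = 'D_v f x + 'D_v g x.
Proof. by move=> cf cg; apply: deriveD; exact: C1_derivable. Qed.

Lemma C1_deriveB f g x v : C1 f -> C1 g ->
  'D_v (fun x => f x - g x) x = 'D_v f x - 'D_v g x.
Proof. by move=> cf cg; apply: deriveB; exact: C1_derivable. Qed.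

Lemma C1_deriveM f g x v : C1 f -> C1 g ->
  'D_v (fun x => f x * g x) x = f x * 'D_v g x + g x * 'D_v f x.
Proof. by move=> cf cg; apply: deriveM; exact: C1_derivable. Qed.

Lemma C1D f g : C1 f -> C1 g -> C1 (fun x => f x + g x).
Proof.
move=> cf cg; split=> [x|v]; first by apply: differentiableD; [exact: cf.1|exact: cg.1].
under eq_fun do rewrite C1_deriveD//.
by apply: continuousD_fun; [exact: cf.2|exact: cg.2].
Qed.

Lemma C1B f g : C1 f -> C1 g -> C1 (fun x => f x - g x).
Proof.
move=> cf cg; split=> [x|v]; first by apply: differentiableB; [exact: cf.1|exact: cg.1].
under eq_fun do rewrite C1_deriveB//.
by apply: continuousB_fun; [exact: cf.2|exact: cg.2].
Qed.

Lemma C1M f g : C1 f -> C1 g -> C1 (fun x => f x * g x).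
Proof.
move=> cf cg; split=> [x|v]; first by apply: differentiableM; [exact: cf.1|exact: cg.1].
under eq_fun do rewrite C1_deriveM//.
apply: continuousD_fun; apply: continuousM_fun.
- exact: C1_continuous.
- exact: cg.2.
- exact: C1_continuous.
- exact: cf.2.
Qed.

Lemma C1_sum I (r : seq I) (f : I -> 'rV[R]_n -> R) :
  (forall i, C1 (f i)) -> C1 (fun x => \sum_(i <- r) f i x).
Proof.
move=> cf; elim: r => [|i r IH].
  by under eq_fun do rewrite big_nil; exact: C1_cst.
by under eq_fun do rewrite big_cons; exact: C1D.
Qed.

Lemma C1_prod I (r : seq I) (f : I -> 'rV[R]_n -> R) :
  (forall i, C1 (f i)) -> C1 (fun x => \prod_(i <- r) f i x).
Proof.
move=> cf; elim: r => [|i r IH].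
  by under eq_fun do rewrite big_nil; exact: C1_cst.
by under eq_fun do rewrite big_cons; exact: C1M.
Qed.

Lemma C1_exp f k : C1 f -> C1 (fun x => f x ^+ k).
Proof.
move=> cf; elim: k => [|k IH]; first by under eq_fun do rewrite expr0; exact: C1_cst.
by under eq_fun do rewrite exprS; exact: C1M.
Qed.

End C1_closure.

Lemma C1_affine (R : realType) n d (f : 'rV[R]_d -> R) (A : 'M[R]_(n, d)) b :
  C1 f -> C1 (fun x => f (x *m A + b)).
Proof.
move=> cf; split=> [x|v].
  apply: (@differentiable_comp _ _ _ _ (fun x => x *m A + b) f); last exact: cf.1.
  apply: differentiableD; last exact: differentiable_cst.
  apply: (@linear_differentiable _ _ _ (mulmxr A)) => y.
  have := @continuous_affine R n d A 0 y; congr (continuous_at _ _).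
  by apply/funext => z; rewrite addr0.
under eq_fun do rewrite derive_affine.
move=> x; have := @continuous_comp _ _ _ (fun x : 'rV[R]_n => x *m A + b)
  (fun z => 'D_(v *m A) f z) x (@continuous_affine R n d A b x) (cf.2 _ _).
exact.
Qed.

Lemma C1_meval (R : realType) n (p : mpoly n R) :
  C1 (fun x : 'rV[R]_n => meval (x 0) p).
Proof.
under eq_fun do rewrite mevalE.
apply: C1_sum => m; apply: C1M; first exact: C1_cst.
apply: C1_prod => i; apply: C1_exp; exact: C1_coord.
Qed.

(** * The derivative of a determinant *)

Lemma deriv_prod (R : comNzRingType) (I : eqType) (r : seq I) (f : I -> {poly R}) :
  uniq r ->
  deriv (\prod_(i <- r) f i) =
  \sum_(i <- r) deriv (f i) * \prod_(j <- r | j != i) f j.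
Proof.
elim: r => [_|a r IH /= /andP[ar ur]]; first by rewrite !big_nil derivC.
rewrite !big_cons derivM IH// eqxx mulr_sumr; congr (_ * _ + _).
  rewrite [RHS]big_seq_cond [LHS]big_seq; apply: eq_bigl => i.
  by case: (boolP (i \in r)) => //= ir; apply/esym/eqP => ia; move: ar; rewrite -ia ir.
rewrite [LHS]big_seq [RHS]big_seq; apply: eq_bigr => i ir.
have ai : a != i by apply: contraNneq ar => ->.
by rewrite big_cons ai mulrCA.
Qed.

(** Each term of the product rule is a determinant with one row
    differentiated, which is expanded along this row. *)
Lemma deriv_det (R : comNzRingType) n (M : 'M[{poly R}]_n) :
  deriv (\det M) = \tr (\adj M *m map_mx (@deriv R) M).
Proof.
pose N k : 'M[{poly R}]_n := \matrix_(i, j) if i == k then deriv (M i j) else M i j.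
transitivity (\sum_k \det (N k)).
  rewrite /determinant raddf_sum exchange_big/=; apply: eq_bigr => s _.
  rewrite -mulr_sumr; have -> : (-1) ^+ s = ((-1) ^+ s)%:P :> {poly R}.
    by rewrite rmorphXn/= rmorphN1.
  rewrite derivM derivC mul0r add0r; congr (_ * _).
  rewrite deriv_prod ?index_enum_uniq//; apply: eq_bigr => k _.
  rewrite [RHS](bigD1 k)//= mxE eqxx; congr (_ * _).
  by apply: eq_bigr => i ik; rewrite mxE (negbTE ik).
rewrite /mxtrace; under [RHS]eq_bigr do rewrite mxE.
rewrite [RHS]exchange_big/=; apply: eq_bigr => k _.
rewrite (expand_det_row _ k); apply: eq_bigr => j _.
rewrite !mxE eqxx mulrC; congr (_ * _).
rewrite /cofactor; congr (_ * \det _); apply/matrixP => i l.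
by rewrite !mxE eq_sym (negbTE (neq_lift _ _)).
Qed.

Lemma is_derive_det (R : realType) n (E V : 'M[R]_n) (t : R) :
  is_derive t 1 (fun t : R => \det (E + t *: V)) (\tr (\adj (E + t *: V) *m V)).
Proof.
pose M : 'M[{poly R}]_n := map_mx (@polyC R) E + 'X *: map_mx (@polyC R) V.
have ME (s : R) : map_mx (horner_eval s) M = E + s *: V.
  by apply/matrixP => i j; rewrite !mxE /horner_eval !hornerE mulrC.
have pE s : (\det M).[s] = \det (E + s *: V).
  by rewrite -ME det_map_mx.
have dpE : (deriv (\det M)).[t] = \tr (\adj (E + t *: V) *m V).
  rewrite deriv_det -[LHS]/(horner_eval t _) -trace_map_mx map_mxM map_mx_adj ME.
  congr (\tr (_ *m _)); apply/matrixP => i j; rewrite !mxE /horner_eval.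
  by rewrite derivD derivM derivX !derivC mul1r mulr0 add0r addr0; exact: hornerC.
rewrite -dpE; have := is_derive_poly (\det M) t.
by congr (is_derive _ _ _ _); apply/funext => s; rewrite pE.
Qed.

Lemma continuous_prod (R : realType) (T : topologicalType) I (r : seq I)
    (f : I -> T -> R) :
  (forall i, continuous (f i)) -> continuous (fun x => \prod_(i <- r) f i x).
Proof.
move=> cf; elim: r => [|i r IH].
  by under eq_fun do rewrite big_nil; exact: continuous_cst.
by under eq_fun do rewrite big_cons; exact: continuousM_fun.
Qed.

Lemma continuous_det (R : realType) (T : topologicalType) n (M : T -> 'M[R]_n) :
  (forall i j, continuous (fun x => M x i j)) -> continuous (fun x => \det (M x)).
Proof.
move=> cM; apply: continuous_sum => s; apply: continuousM_fun.
  exact: continuous_cst.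
by apply: continuous_prod => i; exact: cM.
Qed.

Lemma continuous_adj (R : realType) (T : topologicalType) n (M : T -> 'M[R]_n) i j :
  (forall i j, continuous (fun x => M x i j)) ->
  continuous (fun x => (\adj (M x)) i j).
Proof.
move=> cM; under eq_fun do rewrite mxE.
apply: continuousM_fun; first exact: continuous_cst.
apply: continuous_det => k l; under eq_fun do rewrite !mxE; exact: cM.
Qed.

(** * One moving simplex *)

Lemma bary_interp_param (R : realType) d m (P : 'I_d.+1 -> 'rV[R]_d)
    (V : 'I_d.+1 -> 'rV[R]_m) (y : 'rV[R]_d) :
  edge_mx P \in unitmx -> bary_interp P V (param P y) = param V y.
Proof. by move=> uP; rewrite /bary_interp /param [_ + _ *m _ - _]addrC addKr mulmxK. Qed.

Lemma bary_interpE (R : realType) d m (P : 'I_d.+1 -> 'rV[R]_d)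
    (V : 'I_d.+1 -> 'rV[R]_m) :
  bary_interp P V = fun x => x *m (invmx (edge_mx P) *m edge_mx V) +
    (V ord0 - P ord0 *m (invmx (edge_mx P) *m edge_mx V)).
Proof.
apply/funext => x; rewrite /bary_interp -mulmxA mulmxBl [in RHS]addrCA.
by rewrite addrA.
Qed.

Lemma C1_bary_interp (R : realType) d m (P : 'I_d.+1 -> 'rV[R]_d)
    (V : 'I_d.+1 -> 'rV[R]_m) (f : 'rV[R]_m -> R) :
  C1 f -> C1 (fun x => f (bary_interp P V x)).
Proof. by move=> cf; rewrite bary_interpE; exact: C1_affine. Qed.

Lemma derive_bary_interp (R : realType) d m (P : 'I_d.+1 -> 'rV[R]_d)
    (V : 'I_d.+1 -> 'rV[R]_m) (f : 'rV[R]_m -> R) v x :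
  'D_v (fun x => f (bary_interp P V x)) x =
  'D_(v *m (invmx (edge_mx P) *m edge_mx V)) f (bary_interp P V x).
Proof. by rewrite bary_interpE derive_affine. Qed.

(** The boundary term and the volume term of the scheme differ only by the
    divergence of the mesh velocity, which is constant on the simplex. *)
Lemma simplex_ale_identity (R : realType) n (P V : 'I_n.+2 -> 'rV[R]_n.+1)
    (nu : 'I_n.+2 -> 'rV[R]_n.+1) (psi : 'rV[R]_n.+1 -> R)
    (f : 'I_n.+1 -> 'rV[R]_n.+1 -> R) (c : R) :
  edge_mx P \in unitmx -> (forall i, is_outward_unit_normal P i (nu i)) ->
  C1 psi -> (forall a, C1 (f a)) ->
  (forall x, \sum_a 'D_(delta_mx 0 a) (f a) x = 0) ->
  \sum_i face_area P i * face_int P i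
    (fun x => psi x * \sum_a nu i 0 a * (f a x - bary_interp P V x 0 a * c)) =
  vol_int (simplex P)
    (fun x => \sum_a grad psi x 0 a * (f a x - bary_interp P V x 0 a * c)) -
  c * \tr (invmx (edge_mx P) *m edge_mx V) * vol_int (simplex P) psi.
Proof.
move=> uP hnu cpsi cf df.
pose w a x := bary_interp P V x 0 a.
pose g a x := f a x - w a x * c.
have cw a : C1 (w a) := C1_bary_interp P V (@C1_coord R _ a).
have cwc a : C1 (fun x => w a x * c) by exact: C1M (cw a) (@C1_cst R _ c).
have cg a : C1 (g a) := C1B (cf a) (cwc a).
have := @simplex_divergence R n P nu (fun a x => psi x * g a x) uP hnu
  (fun a => C1M cpsi (cg a)).
have -> : \sum_i face_area P i * face_int P i
      (fun x => \sum_a nu i 0 a * (psi x * g a x)) =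
    \sum_i face_area P i * face_int P i
      (fun x => psi x * \sum_a nu i 0 a * (f a x - bary_interp P V x 0 a * c)).
  apply: eq_bigr => i _; congr (_ * face_int _ _ _); apply/funext => x.
  by rewrite mulr_sumr; apply: eq_bigr => a _; rewrite mulrCA.
move=> <-.
have dw a x : 'D_(delta_mx 0 a) (fun x => w a x * c) x =
    c * (invmx (edge_mx P) *m edge_mx V) a a.
  rewrite C1_deriveM//; last exact: C1_cst.
  rewrite derive_cst mulr0 add0r; congr (_ * _).
  by rewrite (derive_bary_interp P V (fun z => z 0 a)) derive_coord -rowE mxE.
pose dpsi a x := grad psi x 0 a.
have dpsiE a x : dpsi a x = 'D_(delta_mx 0 a) psi x by rewrite /dpsi mxE.
have E x : \sum_a 'D_(delta_mx 0 a) (fun x => psi x * g a x) x =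
    \sum_(b : bool) (if b then 1 else - (c * \tr (invmx (edge_mx P) *m edge_mx V))) *
      (if b then \sum_a dpsi a x * g a x else psi x).
  rewrite big_bool/= mul1r mulNr.
  transitivity (\sum_a (dpsi a x * g a x + psi x * ('D_(delta_mx 0 a) (f a) x -
      c * (invmx (edge_mx P) *m edge_mx V) a a))).
    apply: eq_bigr => a _; rewrite C1_deriveM// C1_deriveB// dw -dpsiE.
    by rewrite addrC mulrC.
  rewrite big_split/=; congr (_ + _); rewrite -mulr_sumr sumrB df sub0r.
  by rewrite /mxtrace mulr_sumr mulrN mulrC.
under eq_fun do rewrite E.
rewrite (@vol_int_simplex_sum R n.+1 P bool _
  (fun b => if b then 1 else - (c * \tr (invmx (edge_mx P) *m edge_mx V)))
  (fun (b : bool) x => if b then \sum_a dpsi a x * g a x else psi x))//.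
  by rewrite big_bool/= mul1r mulNr.
case; last exact: C1_continuous.
apply: continuous_sum => a; apply: continuousM_fun; last exact: C1_continuous.
by rewrite (funext (dpsiE a)); exact: cpsi.2.
Qed.

Lemma invmx_adj (R : realType) n (E : 'M[R]_n) :
  E \in unitmx -> \det E *: invmx E = \adj E.
Proof.
move=> uE; rewrite /invmx uE scalerA divff ?scale1r//.
by rewrite -unitfE -unitmxE.
Qed.

(** After the change of variables, the inverse of the edge matrix is absorbed by
    the Jacobian into the adjugate, which is polynomial in the vertices. *)
Lemma vol_int_flux_param (R : realType) n (P V Khat : 'I_n.+2 -> 'rV[R]_n.+1)
    (q : 'rV[R]_n.+1 -> R) (f : 'I_n.+1 -> 'rV[R]_n.+1 -> R) (c : R) :
  0 < \det (edge_mx P) -> C1 q -> (forall a, continuous (f a)) ->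
  vol_int (simplex P) (fun x => \sum_a
    grad (fun x => q (bary_interp P Khat x)) x 0 a *
      (f a x - bary_interp P V x 0 a * c)) =
  std_int (fun y => \sum_a
    (\sum_b (\adj (edge_mx P) *m edge_mx Khat) a b * 'D_(delta_mx 0 b) q (param Khat y)) *
      (f a (param P y) - param V y 0 a * c)).
Proof.
move=> dP cq cf.
have uP : edge_mx P \in unitmx by rewrite unitmxE unitfE gt_eqF.
have cpsi := C1_bary_interp P Khat cq.
have cw a : continuous (fun x => bary_interp P V x 0 a).
  exact: (C1_continuous (C1_bary_interp P V (@C1_coord R _ a))).
have cF : continuous (fun x => \sum_a
    grad (fun x => q (bary_interp P Khat x)) x 0 a *
      (f a x - bary_interp P V x 0 a * c)).
  apply: continuous_sum => a; apply: continuousM_fun.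
    by under eq_fun do rewrite mxE; exact: cpsi.2.
  apply: continuousB_fun => //; apply: continuousM_fun => //; exact: continuous_cst.
rewrite vol_int_simplex// gtr0_norm// -std_intZ; last exact: continuous_comp_param.
congr std_int; apply/funext => y /=; rewrite mulr_sumr; apply: eq_bigr => a _.
rewrite mulrA bary_interp_param//; congr (_ * _).
rewrite mxE derive_bary_interp bary_interp_param// derive_dir; last exact: cq.1.
rewrite mulr_sumr; apply: eq_bigr => b _; rewrite mulrA; congr (_ * _).
by rewrite -invmx_adj// -scalemxAl -rowE !mxE.
Qed.

Section moving_simplex.
Variables (R : realType) (n : nat) (a b : R).
Variables (X V Khat : 'I_n.+2 -> 'rV[R]_n.+1).
Hypothesis ab : a < b.

Definition moved (t : R) (i : 'I_n.+2) : 'rV[R]_n.+1 := X i + (t - a) *: V i.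

Let E t := edge_mx (moved t).

Lemma edge_moved t : E t = (edge_mx X - a *: edge_mx V) + t *: edge_mx V.
Proof. by apply/matrixP => i j; rewrite !mxE; ring.
Qed.

Lemma param_moved t y : param (moved t) y = param X y + (t - a) *: param V y.
Proof.
rewrite !paramE scaler_sumr -big_split/=; apply: eq_bigr => i _.
by rewrite /moved scalerDr !scalerA [_ * (t - a)]mulrC.
Qed.

Lemma continuous_edge_moved i j : continuous (fun t => E t i j).
Proof.
have -> : (fun t => E t i j) =
    (fun t => (edge_mx X - a *: edge_mx V) i j + t * edge_mx V i j).
  by apply/funext => t; rewrite edge_moved [LHS]mxE [in X in _ + X]mxE.
apply: continuousD_fun; first exact: continuous_cst.
by apply: continuousM_fun; [move=> t; exact: cvg_id|exact: continuous_cst].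
Qed.

Let dJ t := \tr (\adj (E t) *m edge_mx V).

Lemma continuous_dJ : continuous dJ.
Proof.
have -> : dJ = fun t => \sum_i \sum_j (\adj (E t)) i j * edge_mx V j i.
  by apply/funext => t; apply: eq_bigr => i _; rewrite mxE.
apply: continuous_sum => i; apply: continuous_sum => j.
apply: continuousM_fun; last exact: continuous_cst.
apply: continuous_adj; exact: continuous_edge_moved.
Qed.

(** [dJ] is the derivative of the Jacobian, by the formula of Jacobi. *)
Lemma integral_dJ :
  (\int[lebesgue_measure]_(t in `[a, b]) dJ t)%R = \det (E b) - \det (E a).
Proof.
have dE (t : R) : is_derive t 1 (fun t : R => \det (E t)) (dJ t).
  rewrite /dJ; under eq_fun do rewrite edge_moved.
  by rewrite edge_moved; exact: is_derive_det.
have cJ : continuous (fun t => \det (E t)).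
  by apply: continuous_det; exact: continuous_edge_moved.
rewrite /Rintegral (@continuous_FTC2 R dJ (fun t => \det (E t)))//.
- by apply: continuous_subspaceT; exact: continuous_dJ.
- split.
  + by move=> x _; exact: (@ex_derive _ _ _ _ _ _ _ (dE x)).
  + apply: cvg_at_right_filter; exact: cJ.
  + apply: cvg_at_left_filter; exact: cJ.
- by move=> x _; rewrite derive1E; exact: (@derive_val _ _ _ _ _ _ _ (dE x)).
Qed.

Variables (q : 'rV[R]_n.+1 -> R) (f : 'I_n.+1 -> 'rV[R]_n.+1 -> R -> R) (c : R).
Hypothesis cq : C1 q.
Hypothesis cf : forall i, continuous (fun p : 'rV[R]_n.+1 * R => f i p.1 p.2).

(* The volume term of the scheme, pulled back to the standard simplex. *)
Let vol_flux t := std_int (fun y => \sum_i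
  (\sum_j (\adj (E t) *m edge_mx Khat) i j * 'D_(delta_mx 0 j) q (param Khat y)) *
  (f i (param (moved t) y) t - param V y 0 i * c)).

Lemma vol_flux_integrable :
  (@lebesgue_measure R).-integrable `[a, b] (EFin \o vol_flux).
Proof.
pose tt (v : 'rV[R]_(1 + n.+1)) : R := v 0 ord0.
pose yy (v : 'rV[R]_(1 + n.+1)) : 'rV[R]_n.+1 := rsubmx v.
pose Phi (v : 'rV[R]_(1 + n.+1)) := \sum_i
  (\sum_j (\adj (E (tt v)) *m edge_mx Khat) i j *
    'D_(delta_mx 0 j) q (param Khat (yy v))) *
  (f i (param (moved (tt v)) (yy v)) (tt v) - param V (yy v) 0 i * c).
have ct : continuous tt by exact: coord_continuous.
have cy : continuous yy.
  apply: continuous_rV => j; rewrite /yy; under eq_fun do rewrite mxE.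
  exact: coord_continuous.
have cpar (Q : 'I_n.+2 -> 'rV[R]_n.+1) : continuous (fun v => param Q (yy v)).
  by move=> v; apply: continuous_comp; [exact: cy|exact: continuous_param].
have cparj (Q : 'I_n.+2 -> 'rV[R]_n.+1) j : continuous (fun v => param Q (yy v) 0 j).
  move=> v; apply: (continuous_comp (f := fun v => param Q (yy v)) (g := fun z => z 0 j)).
    exact: cpar.
  exact: coord_continuous.
have cPhi : continuous Phi.
  apply: continuous_sum => i; apply: continuousM_fun.
    apply: continuous_sum => j; apply: continuousM_fun.
      have -> : (fun v => (\adj (E (tt v)) *m edge_mx Khat) i j) =
          (fun v => \sum_k (\adj (E (tt v))) i k * edge_mx Khat k j).
        by apply/funext => v; rewrite mxE.
      apply: continuous_sum => k; apply: continuousM_fun; last exact: continuous_cst.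
      apply: (@continuous_adj R _ _ (fun v => E (tt v))) => l m v.
      have := continuous_comp (ct v) (@continuous_edge_moved l m (tt v)); exact.
    move=> v; have := continuous_comp (cpar Khat v) (cq.2 (delta_mx 0 j) _); exact.
  apply: continuousB_fun; last first.
    by apply: continuousM_fun; [exact: cparj|exact: continuous_cst].
  have cx : continuous (fun v => param (moved (tt v)) (yy v)).
    apply: continuous_rV => j.
    have -> : (fun v => param (moved (tt v)) (yy v) 0 j) =
        (fun v => param X (yy v) 0 j + (tt v - a) * param V (yy v) 0 j).
      by apply/funext => v; rewrite param_moved !mxE.
    apply: continuousD_fun => //; apply: continuousM_fun => //.
    by apply: continuousB_fun => //; exact: continuous_cst.
  move=> v.
  have cp : {for v, continuous (fun v => (param (moved (tt v)) (yy v), tt v))}.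
    exact: (cvg_pair (cx v) (ct v)).
  have := continuous_comp cp (@cf i _); exact.
rewrite (_ : EFin \o vol_flux =
    (fun t : R => (std_int (fun y : 'rV[R]_n.+1 => Phi (row_mx t%:M y)))%:E)).
  exact: std_int_integrable.
apply/funext => t /=; congr EFin; congr std_int; apply/funext => y.
have t1 : tt (row_mx t%:M y) = t by exact: row_mx_ord0.
have y1 : yy (row_mx t%:M y) = y by exact: row_mxKr.
by rewrite /Phi t1 y1.
Qed.

Hypothesis posE : forall t, a <= t <= b -> 0 < \det (E t).
Variable nu : 'I_n.+2 -> R -> 'rV[R]_n.+1.
Hypothesis hnu : forall i t, a <= t <= b -> is_outward_unit_normal (moved t) i (nu i t).
Hypothesis c1f : forall i t, C1 (fun x => f i x t).
Hypothesis df : forall t x, \sum_i 'D_(delta_mx 0 i) (fun x => f i x t) x = 0.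

(** At each time the two integrands differ by the divergence of the mesh velocity
    times the integral of the basis function, which is [dJ] up to a constant
    factor. The integral of the volume term cancels in the difference; it has to
    be integrable in time for the integral of a difference to split. *)
Lemma moving_simplex_balance :
  let psi t x := q (bary_interp (moved t) Khat x) in
  let w t := bary_interp (moved t) V in
  (\int[lebesgue_measure]_(t in `[a, b])
    (vol_int (simplex (moved t)) (fun x =>
      \sum_i grad (psi t) x 0 i * (f i x t - w t x 0 i * c))))%R -
  (\int[lebesgue_measure]_(t in `[a, b])
    (\sum_k face_area (moved t) k * face_int (moved t) k (fun x =>
      psi t x * \sum_i nu k t 0 i * (f i x t - w t x 0 i * c))))%R =
  c * (\det (E b) - \det (E a)) * std_int (q \o param Khat).
Proof.
move=> psi w.
have uE t : a <= t <= b -> E t \in unitmx.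
  by move=> tab; rewrite unitmxE unitfE gt_eqF// posE.
have AE t : a <= t <= b -> vol_int (simplex (moved t)) (fun x =>
      \sum_i grad (psi t) x 0 i * (f i x t - w t x 0 i * c)) = vol_flux t.
  move=> tab; rewrite (@vol_int_flux_param R n (moved t) V Khat q (fun i x => f i x t) c)//.
    exact: posE.
  by move=> i; exact: (C1_continuous (@c1f i t)).
pose I0 := std_int (q \o param Khat).
have BE t : a <= t <= b -> \sum_k face_area (moved t) k * face_int (moved t) k (fun x =>
      psi t x * \sum_i nu k t 0 i * (f i x t - w t x 0 i * c)) =
    vol_flux t - c * I0 * dJ t.
  move=> tab.
  rewrite (@simplex_ale_identity R n (moved t) V (fun k => nu k t) (psi t)
    (fun i x => f i x t) c (uE t tab)); last 4 first.
  - by move=> i; exact: hnu.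
  - exact: C1_bary_interp.
  - by [].
  - by [].
  rewrite -AE//; congr (_ - _).
  rewrite vol_int_simplex; last 2 first.
  - exact: uE.
  - exact: (C1_continuous (C1_bary_interp (moved t) Khat cq)).
  rewrite gtr0_norm ?posE// /dJ -invmx_adj; last exact: uE.
  rewrite -scalemxAl mxtraceZ.
  have -> : std_int (psi t \o param (moved t)) = I0.
    by congr std_int; apply/funext => y /=; rewrite /psi bary_interp_param//; exact: uE.
  rewrite -/(E t); ring.
have iA := vol_flux_integrable.
have iJ : (@lebesgue_measure R).-integrable `[a, b] (EFin \o (fun t => c * I0 * dJ t)).
  apply: continuous_compact_integrable; first exact: segment_compact.
  apply: continuous_subspaceT; apply: continuousM_fun; last exact: continuous_dJ.
  exact: continuous_cst.
have iJ0 : (@lebesgue_measure R).-integrable `[a, b] (EFin \o dJ).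
  apply: continuous_compact_integrable; first exact: segment_compact.
  by apply: continuous_subspaceT; exact: continuous_dJ.
transitivity ((\int[lebesgue_measure]_(t in `[a, b]) vol_flux t)%R -
    (\int[lebesgue_measure]_(t in `[a, b]) (vol_flux t - c * I0 * dJ t))%R).
  apply: (congr2 (fun x y : R => x - y)); apply: eq_Rintegral => t /set_mem /=.
    by rewrite in_itv; exact: AE.
  by rewrite in_itv; exact: BE.
rewrite RintegralB// opprB addrC subrK RintegralZl// integral_dJ.
by rewrite mulrAC.
Qed.

End moving_simplex.

(** * The flux, the faces and the basis *)

Lemma continuous_rV_coord (R : realType) (T : topologicalType) n (g : T -> 'rV[R]_n) j :
  continuous g -> continuous (fun x => g x 0 j).
Proof.
move=> cg x; apply: (continuous_comp (f := g) (g := fun z => z 0 j)); first exact: cg.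
exact: coord_continuous.
Qed.

Section smooth_flux.
Variables (R : realType) (n N : nat).
Variable F : 'rV[R]_n -> R -> 'rV[R]_N -> 'rV[R]_N.
Hypothesis hF : smooth (fun p : 'rV[R]_n * R * 'rV[R]_N => F p.1.1 p.1.2 p.2).
Variables (c : 'rV[R]_N) (j : 'I_N).

Let F3 (p : 'rV[R]_n * R * 'rV[R]_N) := F p.1.1 p.1.2 p.2.

Let differentiable_slice t x : differentiable (fun y => F y t c) x.
Proof.
have [dF _] := hF 1.
apply: (@differentiable_comp _ _ _ _ (fun y => (y, t, c)) F3); last exact: dF.
apply: differentiable_pair; last exact: differentiable_cst.
by apply: differentiable_pair; last exact: differentiable_cst.
Qed.

Lemma derive_flux_coord t v x :
  'D_v (fun y => F y t c 0 j) x = ('D_v (fun y => F y t c) x) 0 j.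
Proof.
have dx : derivable (fun y => F y t c) x v by exact: diff_derivable.
by rewrite (derive_mx dx) mxE.
Qed.

Lemma C1_flux t : C1 (fun x => F x t c 0 j).
Proof.
have [_ cF] := hF 1.
split=> [x|v].
  apply: (@differentiable_comp _ _ _ _ (fun y => F y t c) (fun z : 'rV[R]_N => z 0 j)).
    exact: differentiable_slice.
  exact: differentiable_coord.
under eq_fun do rewrite derive_flux_coord.
apply: continuous_rV_coord.
have -> : 'D_v (fun y => F y t c) = (fun x => 'D_(v, 0, 0) F3 (x, t, c)).
  apply/funext => x; rewrite /derive.
  apply: (congr1 (fun G : R -> 'rV[R]_N => lim (G @ 0^'))).
  by apply/funext => h /=; rewrite /F3 /= !scaler0 !add0r.
move=> x.
have c1 : {for x, continuous (fun x : 'rV[R]_n => (x, t, c))}.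
  have cx : {for x, continuous (fun y : 'rV[R]_n => (y, t))}.
    exact: (cvg_pair (@cvg_id _ (nbhs x)) (cvg_cst t)).
  exact: (cvg_pair cx (cvg_cst c)).
have c2 : {for x, continuous
    ((fun p => 'D_(v, 0, 0) F3 p) \o (fun y : 'rV[R]_n => (y, t, c)))}.
  exact: (continuous_comp c1 (cF (v, 0, 0) _)).
exact: c2.
Qed.

Lemma continuous_flux : continuous (fun p : 'rV[R]_n * R => F p.1 p.2 c 0 j).
Proof.
have cF : continuous F3 := hF 0.
apply: continuous_rV_coord => p.
have c1 : {for p, continuous (fun p : 'rV[R]_n * R => (p, c))}.
  exact: (cvg_pair (@cvg_id _ (nbhs p)) (cvg_cst c)).
have c2 : {for p, continuous (F3 \o (fun p : 'rV[R]_n * R => (p, c)))}.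
  exact: (continuous_comp c1 (cF _)).
exact: c2.
Qed.

End smooth_flux.

Lemma ale_flux_coord (R : realType) d N
    (F : 'I_d -> 'rV[R]_d -> R -> 'rV[R]_N -> 'rV[R]_N) x t c w v j :
  ale_flux F x t c w v 0 j = \sum_i v 0 i * (F i x t c 0 j - w 0 i * c 0 j).
Proof. by rewrite summxE; apply: eq_bigr => i _; rewrite !mxE. Qed.

Lemma simplex_sub_vertices (R : realType) n m d (Q : 'I_n.+1 -> 'rV[R]_d)
    (P : 'I_m.+1 -> 'rV[R]_d) :
  (forall j, exists k, Q j = P k) -> simplex Q `<=` simplex P.
Proof.
move=> /choice[k hk] x [a [a0 _ a1 ->]].
exists (fun i => \sum_(j | k j == i) a j); split.
- by move=> i; apply: sumr_ge0 => j _; exact: a0.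
- by move=> i; rewrite inE.
- by rewrite -a1 [RHS](partition_big k xpredT).
- rewrite [LHS](partition_big k xpredT)//=; apply: eq_bigr => i _.
  rewrite scaler_suml; apply: eq_bigr => j /eqP <-.
  by rewrite hk.
Qed.

Section mesh.
Variables (R : realType) (d : nat) (M : moving_mesh R d.+1) (K : cell M) (t : R).
Variable nu : 'I_d.+2 -> 'rV[R]_d.+1.
Hypothesis hnu : forall i, is_outward_unit_normal (cell_vtx K t) i (nu i).

(** The outward normal separates a vertex from the others, hence the nodes of a
    cell are distinct. *)
Lemma node_neq i j : j != i -> node K j != node K i.
Proof.
move=> ji; have [_ _ /(_ j ji) h] := hnu i.
apply/eqP => Kji; move: h; rewrite /cell_vtx Kji subrr /dotv.
by rewrite big1 ?ltxx// => k _; rewrite mxE mul0r.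
Qed.

Lemma face_sub_cell i : simplex (face_vtx K i t) `<=` cell_set K t.
Proof. by apply: simplex_sub_vertices => j; exists (lift i j). Qed.

Lemma face_sub_neighbour i L :
  neighbour K i = Some L -> simplex (face_vtx K i t) `<=` cell_set L t.
Proof.
rewrite /neighbour; case: pickP => // L' /andP[_ /fintype.subsetP sub] [<-].
apply: simplex_sub_vertices => j.
have : node K (lift i j) \in cell_nodes L'.
  apply: sub; rewrite in_setD1 node_neq ?imset_f//.
  by rewrite eq_sym neq_lift.
by move=> /imsetP[k _ jk]; exists k; rewrite /face_vtx /cell_vtx jk.
Qed.

End mesh.

Lemma coordB (R : realType) N (A B : 'rV[R]_N) j : (A - B) 0 j = A 0 j - B 0 j.
Proof. by rewrite !mxE. Qed.

Lemma vol_intvE (R : realType) n N (D : set 'rV[R]_n) (f : 'rV[R]_n -> 'rV[R]_N) j :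
  vol_intv D f 0 j = vol_int D (fun x => f x 0 j).
Proof. by rewrite mxE. Qed.

Lemma time_intvE (R : realType) N (a b : R) (f : R -> 'rV[R]_N) j :
  time_intv a b f 0 j = (\int[lebesgue_measure]_(t in `[a, b]) f t 0 j)%R.
Proof. by rewrite mxE. Qed.

Lemma vol_int_simplexZ (R : realType) n (P : 'I_n.+1 -> 'rV[R]_n) (s : R)
    (f : 'rV[R]_n -> R) :
  edge_mx P \in unitmx -> continuous f ->
  vol_int (simplex P) (fun x => s * f x) = s * vol_int (simplex P) f.
Proof.
move=> uP cf.
have := @vol_int_simplex_sum R n P 'I_1 (index_enum 'I_1) (fun=> s) (fun=> f) uP (fun=> cf).
by rewrite big_ord1 => <-; apply: eq_vol_int => x _; rewrite big_ord1.
Qed.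

(** The polynomial 1 is a combination of the basis, and by orthonormality its
    coefficient on each basis function is the integral of that function. *)
Lemma orthonormal_basis_one (R : realType) d k n (Khat : 'I_d.+1 -> 'rV[R]_d)
    (phihat : 'I_n.+1 -> mpoly d R) :
  edge_mx Khat \in unitmx -> orthonormal_basis k Khat phihat ->
  forall xi : 'rV[R]_d,
    \sum_m vol_int (simplex Khat) (fun x => meval (x 0) (phihat m)) *
      meval (xi 0) (phihat m) = 1.
Proof.
move=> uK [_ span orth _] xi; pose q m (x : 'rV[R]_d) := meval (x 0) (phihat m).
have cq m : continuous (q m) := C1_continuous (C1_meval (phihat m)).
have [|a [a1 _]] := span 1; first by rewrite msize1.
have one x : \sum_m a m * q m x = 1.
  rewrite -(meval1 (x 0)) a1 raddf_sum /=; apply: eq_bigr => m _.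
  by rewrite mevalZ.
rewrite -[RHS](one xi); apply: eq_bigr => m _; congr (_ * _).
transitivity (vol_int (simplex Khat) (fun x => \sum_l a l * (q l x * q m x))).
  by apply: eq_vol_int => x _; rewrite -/(q m x) -[LHS]mul1r -(one x) mulr_suml;
    apply: eq_bigr => l _; rewrite mulrA.
rewrite vol_int_simplex_sum//; last by move=> l; exact: continuousM_fun.
under eq_bigr do rewrite orth.
rewrite (bigD1 m)//= eqxx mulr1 big1 ?addr0// => l /negbTE ->.
by rewrite mulr0.
Qed.

Theorem mainTheorem1 (R : realType) (d N k n : nat)
  (tn tn1 : R) (htn : tn < tn1)
  (* the flux *)
  (F : 'I_d.+1 -> 'rV[R]_d.+1 -> R -> 'rV[R]_N -> 'rV[R]_N)
  (hF : forall i, smooth (fun p : 'rV[R]_d.+1 * R * 'rV[R]_N =>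
          F i p.1.1 p.1.2 p.2))
  (* the moving mesh *)
  (M : moving_mesh R d.+1) (Omega : R -> set 'rV[R]_d.+1)
  (hvel : constant_velocities M tn tn1)
  (hconf : forall t, tn <= t <= tn1 -> conforming_mesh M t (Omega t))
  (hpos : forall t, tn <= t <= tn1 -> positively_oriented M t)
  (nu : cell M -> 'I_d.+2 -> R -> 'rV[R]_d.+1)
  (hnu : forall K i t, tn <= t <= tn1 ->
          is_outward_unit_normal (cell_vtx K t) i (nu K i t))
  (* the reference simplex and the basis *)
  (Khat : 'I_d.+2 -> 'rV[R]_d.+1) (hKhat : edge_mx Khat \in unitmx)
  (phihat : 'I_n.+1 -> mpoly d.+1 R)
  (hphi : orthonormal_basis k Khat phihat)
  (* the numerical flux *)
  (H : 'rV[R]_d.+1 -> R -> 'rV[R]_N -> 'rV[R]_N -> 'rV[R]_d.+1 ->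
       'rV[R]_d.+1 -> 'rV[R]_N)
  (hH : consistent_flux F H)
  (* the constant state *)
  (c : 'rV[R]_N)
  (hc : forall x t, divergence (fun i y => F i y t c) x = 0)
  (* the predictor, and the exterior state on the boundary faces *)
  (ut : cell M -> R -> 'rV[R]_d.+1 -> 'rV[R]_N)
  (hut : forall K t x, tn <= t <= tn1 -> cell_set K t x -> ut K t x = c)
  (uext : cell M -> 'I_d.+2 -> R -> 'rV[R]_d.+1 -> 'rV[R]_N)
  (huext : forall K i t x, tn <= t <= tn1 -> neighbour K i = None ->
          simplex (face_vtx K i t) x -> uext K i t x = c)
  (* the discrete solution *)
  (coef : cell M -> 'I_n.+1 -> R -> 'rV[R]_N)
  (hun : forall K x, cell_set K tn x ->
          discrete_solution Khat phihat coef K tn x = c)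
  (hscheme : ale_dg_scheme Khat phihat F H nu ut uext
          (discrete_solution Khat phihat coef) tn tn1) :
  forall K x, cell_set K tn1 x ->
    discrete_solution Khat phihat coef K tn1 x = c.
Proof.
move=> K; pose X := cell_vtx K tn; pose V i := velocity (node K i).
have I0 : tn <= tn <= tn1 by rewrite lexx ltW.
have I1 : tn <= tn1 <= tn1 by rewrite lexx ltW.
have mv t : tn <= t <= tn1 -> cell_vtx K t = moved tn X V t.
  by move=> tI; apply/funext => i; rewrite /cell_vtx hvel.
pose E t := edge_mx (moved tn X V t).
have posE t : tn <= t <= tn1 -> 0 < \det (E t).
  by move=> tI; rewrite /E -mv//; exact: hpos.
have uE t : tn <= t <= tn1 -> E t \in unitmx.
  by move=> tI; rewrite unitmxE unitfE gt_eqF// posE.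
pose q m (x : 'rV[R]_d.+1) := meval (x 0) (phihat m).
have cq m : C1 (q m) := C1_meval (phihat m).
have cqc m : continuous (q m) := C1_continuous (cq m).
pose psi m t x := q m (bary_interp (moved tn X V t) Khat x).
have cpsi m t : continuous (psi m t).
  exact: (C1_continuous (C1_bary_interp (moved tn X V t) Khat (cq m))).
pose J m := std_int (q m \o param Khat).
pose D := `|\det (edge_mx Khat)|.
have D0 : 0 < D by rewrite normr_gt0 -unitfE -unitmxE.
have psi_param m t y : tn <= t <= tn1 ->
    psi m t (param (moved tn X V t) y) = q m (param Khat y).
  by move=> tI; rewrite /psi bary_interp_param//; exact: uE.
have phiE m t : tn <= t <= tn1 -> basis_fun Khat phihat K m t = psi m t.
  by move=> tI; rewrite /basis_fun mv.
have cellE t : tn <= t <= tn1 -> cell_set K t = simplex (moved tn X V t).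
  by move=> tI; rewrite /cell_set mv.
have volE m t : tn <= t <= tn1 ->
    vol_int (simplex (moved tn X V t)) (psi m t) = \det (E t) * J m.
  move=> tI; rewrite (vol_int_simplex (uE t tI) (cpsi m t)) gtr0_norm; last exact: posE.
  congr (_ * std_int _); apply/funext => y; exact: psi_param.
(* The right-hand side of the scheme is the difference computed by the balance of
   the moving simplex, so the new solution has the moments of the constant [c]. *)
have new_moment m j : vol_int (cell_set K tn1)
    (fun x => psi m tn1 x * discrete_solution Khat phihat coef K tn1 x 0 j) =
    c 0 j * \det (E tn1) * J m.
  have bal := @moving_simplex_balance R d tn tn1 X V Khat htn (q m)
    (fun i x t => F i x t c 0 j) (c 0 j) (cq m)
    (fun i => @continuous_flux R _ _ (F i) (hF i) c j) posE (fun i t => nu K i t).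
  have {}bal := bal (fun i t tI => eq_ind _ (fun P => is_outward_unit_normal P i (nu K i t))
    (hnu K i t tI) _ (mv t tI)).
  have {}bal := bal (fun i t => @C1_flux R _ _ (F i) (hF i) c j t).
  have df t x : \sum_i 'D_(delta_mx 0 i) (fun y => F i y t c 0 j) x = 0.
    transitivity ((divergence (fun i y => F i y t c) x) 0 j); last by rewrite hc mxE.
    rewrite /divergence summxE; apply: eq_bigr => i _.
    exact: (@derive_flux_coord R _ _ (F i) (hF i)).
  have {}bal := bal df.
  have sch := congr1 (fun A : 'rV[R]_N => A 0 j) (hscheme K m).
  rewrite /= !coordB !vol_intvE !time_intvE in sch.
  have L0 : vol_int (cell_set K tn) (fun x => (basis_fun Khat phihat K m tn x *:
      discrete_solution Khat phihat coef K tn x) 0 j) = c 0 j * \det (E tn) * J m.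
    rewrite -mulrA -(volE m tn I0) -(@vol_int_simplexZ R _ _ (c 0 j) _ (uE tn I0) (cpsi m tn)) (cellE tn I0).
    apply: eq_vol_int => x Kx; rewrite mxE hun ?cellE// phiE// mulrC.
    by [].
  have L1 : vol_int (cell_set K tn1) (fun x => (basis_fun Khat phihat K m tn1 x *:
      discrete_solution Khat phihat coef K tn1 x) 0 j) = vol_int (cell_set K tn1)
    (fun x => psi m tn1 x * discrete_solution Khat phihat coef K tn1 x 0 j).
    by apply: eq_vol_int => x _; rewrite mxE phiE.
  rewrite L0 L1 in sch.
  have R1 t : tn <= t <= tn1 -> vol_intv (cell_set K t) (fun x =>
      ale_flux F x t (ut K t x) (mesh_velocity K t x)
        (grad (basis_fun Khat phihat K m t) x)) 0 j =
    vol_int (simplex (moved tn X V t)) (fun x =>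
      \sum_i grad (psi m t) x 0 i *
        (F i x t c 0 j - bary_interp (moved tn X V t) V x 0 i * c 0 j)).
    move=> tI; rewrite vol_intvE -cellE//; apply: eq_vol_int => x Kx.
    by rewrite hut// ale_flux_coord phiE// /mesh_velocity mv.
  have R2 t : tn <= t <= tn1 -> (\sum_(i < d.+2)
      surf_intv (face_vtx K i t) (fun x => basis_fun Khat phihat K m t x *:
        H x t (ut K t x) (outer_trace ut uext K i t x)
          (mesh_velocity K t x) (nu K i t))) 0 j =
    \sum_i face_area (moved tn X V t) i * face_int (moved tn X V t) i (fun x =>
      psi m t x * \sum_l nu K i t 0 l *
        (F l x t c 0 j - bary_interp (moved tn X V t) V x 0 l * c 0 j)).
    move=> tI; rewrite summxE; apply: eq_bigr => i _; rewrite mxE vol_intvE -mv//.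
    congr (_ * _); apply: eq_vol_int => y Sy.
    have fy : simplex (face_vtx K i t) (param (face_vtx K i t) y) by exact: simplex_param.
    have ky := @face_sub_cell _ _ _ K t i _ fy.
    rewrite /= mxE -phiE//.
    rewrite -[face_vtx K i t ord0 + _]/(param (face_vtx K i t) y) hut//.
    have -> : outer_trace ut uext K i t (param (face_vtx K i t) y) = c.
      rewrite /outer_trace; case nb : (neighbour K i) => [L|]; last exact: huext.
      apply: hut => //.
      exact: (@face_sub_neighbour _ _ _ K t _ (fun i => hnu K i t tI) i L nb _ fy).
    by rewrite hH ale_flux_coord /mesh_velocity.
  move: sch.
  rewrite (_ : Rintegral _ _ _ = (\int[lebesgue_measure]_(t in `[tn, tn1])
    (vol_int (simplex (moved tn X V t)) (fun x =>
      \sum_i grad (psi m t) x 0 i *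
        (F i x t c 0 j - bary_interp (moved tn X V t) V x 0 i * c 0 j))))%R); last first.
    by apply: eq_Rintegral => t /set_mem /=; rewrite in_itv; exact: R1.
  rewrite [X in _ = _ - X](_ : _ = (\int[lebesgue_measure]_(t in `[tn, tn1])
    (\sum_i face_area (moved tn X V t) i * face_int (moved tn X V t) i (fun x =>
      psi m t x * \sum_l nu K i t 0 l *
        (F l x t c 0 j - bary_interp (moved tn X V t) V x 0 l * c 0 j))))%R); last first.
    by apply: eq_Rintegral => t /set_mem /=; rewrite in_itv; exact: R2.
  rewrite bal => /eqP; rewrite subr_eq => /eqP ->.
  by rewrite -/(J m) -!/(E _) -mulrDl -mulrDr subrK.
have orth l m : std_int (fun y => q l (param Khat y) * q m (param Khat y)) = (l == m)%:R / D.
  have [_ _ /(_ l m) o _] := hphi.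
  have cqq : continuous (fun x => q l x * q m x) by exact: continuousM_fun.
  by rewrite -o (vol_int_simplex hKhat cqq) [_ * std_int _]mulrC mulfK ?gt_eqF.
pose a m := vol_int (simplex Khat) (q m).
have aJ m : a m = D * J m by rewrite /a (vol_int_simplex hKhat (cqc m)).
(* The moments of the new solution are also its coefficients, up to the ratio of
   the two Jacobians. *)
have coefE m j : coef K m tn1 0 j = c 0 j * a m.
  have := new_moment m j.
  have -> : vol_int (cell_set K tn1)
      (fun x => psi m tn1 x * discrete_solution Khat phihat coef K tn1 x 0 j) =
    vol_int (simplex (moved tn X V tn1))
      (fun x => \sum_l coef K l tn1 0 j * (psi l tn1 x * psi m tn1 x)).
    rewrite cellE//; apply: eq_vol_int => x _; rewrite summxE mulr_sumr.
    by apply: eq_bigr => l _; rewrite mxE phiE// mulrCA mulrC -mulrA mulrC -mulrA [psi l _ _ * _]mulrC.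
  rewrite (@vol_int_simplex_sum R _ _ _ _ (fun l => coef K l tn1 0 j)
    (fun l x => psi l tn1 x * psi m tn1 x) (uE tn1 I1)); last first.
    by move=> l; apply: continuousM_fun; exact: cpsi.
  have Il l : vol_int (simplex (moved tn X V tn1)) (fun x => psi l tn1 x * psi m tn1 x) =
      \det (E tn1) * ((l == m)%:R / D).
    rewrite (vol_int_simplex (uE tn1 I1)); last by apply: continuousM_fun; exact: cpsi.
    rewrite gtr0_norm ?posE// -orth; congr (_ * std_int _).
    by apply/funext => y /=; rewrite !psi_param.
  under eq_bigr do rewrite Il.
  rewrite (bigD1 m)//= eqxx big1 ?addr0; last first.
    by move=> l /negbTE ->; rewrite mul0r !mulr0.
  move=> eqn; have d0 := lt0r_neq0 (posE tn1 I1); have D1 := lt0r_neq0 D0.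
  apply: (mulfI d0); apply: (mulIf (invr_neq0 D1)).
  transitivity (coef K m tn1 0 j * (\det (E tn1) * (1 / D))); first by ring.
  by rewrite eqn aJ; field.
move=> x Kx; apply/rowP => j.
rewrite summxE.
transitivity (\sum_m (c 0 j * (a m * q m (bary_interp (moved tn X V tn1) Khat x)))).
  by apply: eq_bigr => m _; rewrite mxE phiE// coefE mulrCA [_ * a m]mulrC.
by rewrite -mulr_sumr (@orthonormal_basis_one R _ _ _ Khat phihat hKhat hphi) mulr1.
Qed.
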